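(* For every integer $n\ge 2$, \[ \mathcal{LE}\big(M_n(\mathbb{C})^{sa}\big)=2n\Big(\frac{n}{n+1}\Big)^{n-1}-1 . \]
   Context: $M_n(\mathbb{C})^{sa}$ is the real Banach space of self-adjoint complex $n\times n$ matrices equipped with the operator norm. For a function $f$ from a subset $X$ of a metric space $(Z,\rho)$ into a Banach space $V$, $L(f)=\sup\{\|f(x)-f(y)\|/\rho(x,y): x\neq y\}$. $\mathcal{LE}(V)$ is the infimum of the constants $c$ such that for every metric space $(Z,\rho)$, every $X\subseteq Z$ and every $f:X\to V$ there is an extension $g:Z\to V$ of $f$ with $L(g)\le cL(f)$. *)

(* Defs.v *)
From HB Require Import structures.
From mathcomp Require Import all_boot all_order all_algebra.
From mathcomp Require Import all_classical all_reals.
From mathcomp Require Import ereal complex.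
Set Implicit Arguments. Unset Strict Implicit. Unset Printing Implicit Defensive.
Import Order.TTheory GRing.Theory Num.Theory.
Local Open Scope ring_scope.
Local Open Scope classical_set_scope.

Section Defs.
Variable R : realType.
Local Notation C := (complex R).

Definition adjmx (n : nat) (A : 'M[C]_n) : 'M[C]_n :=
  \matrix_(i, j) conjc (A j i).

Definition selfadj (n : nat) (A : 'M[C]_n) : Prop := adjmx A = A.

Definition vnorm (n : nat) (v : 'cV[C]_n) : R :=
  Num.sqrt (\sum_i ((complex.Re (v i 0)) ^+ 2 + (complex.Im (v i 0)) ^+ 2)).

Definition opnorm (n : nat) (A : 'M[C]_n) : R :=
  sup [set vnorm (A *m v) | v in [set v : 'cV[C]_n | vnorm v <= 1]].

Definition is_metric (Z : Type) (rho : Z -> Z -> R) : Prop :=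
  [/\ forall x y, 0 <= rho x y,
      forall x y, rho x y = 0 <-> x = y,
      forall x y, rho x y = rho y x &
      forall x y z, rho x z <= rho x y + rho y z].

(* Lipschitz constant of f restricted to X (sup of the empty set taken as 0) *)
Definition lipc (Z : Type) (rho : Z -> Z -> R) (X : set Z) (n : nat)
  (f : Z -> 'M[C]_n) : \bar R :=
  ereal_sup ([set 0%E] `|`
    [set r | exists x y, [/\ X x, X y, x <> y &
                               r = ((opnorm (f x - f y)) / rho x y)%:E]]).

Definition LE_admissible (n : nat) (c : R) : Prop :=
  forall (Z : Type) (rho : Z -> Z -> R), is_metric rho ->
  forall (X : set Z) (f : Z -> 'M[C]_n), (forall x, X x -> selfadj (f x)) ->
  exists g : Z -> 'M[C]_n,
    [/\ forall z, selfadj (g z),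
        forall x, X x -> g x = f x &
        (lipc rho setT g <= c%:E * lipc rho X f)%E].

(* LE(M_n(C)^sa) as an extended real (+oo if no constant works) *)
Definition LE_sa (n : nat) : \bar R :=
  ereal_inf [set c%:E | c in LE_admissible n].

End Defs.

(* Main.v *)
(** Put [P = n E|(n+1)t - 1|], where [t = |<z, x>|^2] for [z] uniform on the
    unit sphere of [C^n] and [x] a fixed unit vector; [t] has the density
    [(n-1)(1-t)^(n-2)], and [P] is the right-hand side.

    A self-adjoint matrix [A] is reproduced from its quadratic form by
    [A = E_z <Az, z> (n(n+1) z z^* - n)], and the norm of [A] is the supremum of
    its quadratic form on the sphere.  Given a Lipschitz [f], extending each
    scalar function [<f(.)z, z>] by McShane's formula and applying the
    reproducing formula gives an extension whose Lipschitz constant is at most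
    [P] times larger.

    Conversely, let [c] be admissible.  Extending the identity from the
    self-adjoint matrices to all bounded functions on the sphere and averaging
    over translations (Lindenstrauss) gives a linear projection [Q] of norm at
    most [c].  For a polynomial [q] with [|q| <= 1] on [[0, 1]], put
    [h_z(x) = q(|<x, z>|^2)].  By symmetry, [E_z h_z(x) z z^* = a x x^* + b], so
    the average [E_z <Q(h_z) z, z> <= c] does not depend on [Q] and equals
    [n E(q(t) ((n+1)t - 1))]; let [q] approach the sign of [(n+1)t - 1].

    All averages are positive linear functionals defined on every function, so
    that neither measurability nor continuity has to be checked. *)
From mathcomp Require Import all_boot all_order all_algebra.
From mathcomp Require Import all_classical all_reals.
From mathcomp Require Import ereal complex ring lra.
Require Import Defs.
Set Implicit Arguments. Unset Strict Implicit. Unset Printing Implicit Defensive.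
Import Order.TTheory GRing.Theory Num.Theory.
Local Open Scope ring_scope.
Local Open Scope classical_set_scope.

(** * Invariant means *)

Section ConeExtension.
Variables (R : realType) (E : lmodType R) (C : set E) (e : E).
Hypotheses (C0 : C 0) (CD : forall x y, C x -> C y -> C (x + y))
  (CZ : forall (a : R) x, 0 <= a -> C x -> C (a *: x))
  (Ce : ~ C (- e)) (Cub : forall x, C x -> exists K : R, C (K *: e - x)).

Let good (A : set (E * R)) :=
  [/\ forall a x y r s, A (x, r) -> A (y, s) -> A (a *: x + y, a * r + s),
      forall x r, A (x, r) -> C x -> 0 <= r &
      A = set0 \/ A (e, 1)].

Let good_bigcup (F : set (set (E * R))) : F `<=` good -> total_on F subset ->
  good (\bigcup_(A in F) A).
Proof.
move=> Fg Ft; split.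
- move=> a x y r s [A FA Ax] [B FB By].
  have [AB|BA] := Ft _ _ FA FB.
  + by exists B => //; have [h _ _] := Fg _ FB; apply: h => //; apply: AB.
  + by exists A => //; have [h _ _] := Fg _ FA; apply: h => //; apply: BA.
- by move=> x r [A FA Ax] Cx; have [_ h _] := Fg _ FA; apply: h Ax Cx.
- have [[A [FA An]]|h] := pselect (exists A, F A /\ A <> set0).
    by right; exists A => //; have [_ _ []] := Fg _ FA.
  left; rewrite predeqE => x; split => // -[A FA Ax]; apply: h.
  by exists A; split => // A0; rewrite A0 in Ax.
Qed.

Let line := [set z : E * R | exists t, z = (t *: e, t)].

Let good_line : good line.
Proof.
split.
- move=> a x y r s [t [-> ->]] [u [-> ->]]; exists (a * t + u).
  by rewrite scalerDl scalerA.
- move=> x r [t [-> ->]] Ct; rewrite leNgt; apply/negP => t0; apply: Ce.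
  rewrite (_ : - e = (- t)^-1 *: (t *: e)); last first.
    by rewrite scalerA invrN mulNr mulVf ?scaleN1r// lt_eqF.
  by apply: CZ => //; rewrite invr_ge0; lra.
- by right; exists 1; rewrite scale1r.
Qed.

(* Hahn-Banach for a convex cone all of whose elements are dominated by
   multiples of [e]; elements of [E] that are not comparable to the line of
   [e] get an arbitrary value. *)
Lemma cone_extension : exists phi : E -> R,
  [/\ forall a x y, phi (a *: x + y) = a * phi x + phi y,
      phi e = 1 & forall x, C x -> 0 <= phi x].
Proof.
have [A [[Alin Apos A0e] Amax]] := Zorn_bigcup good_bigcup.
have Ae : A (e, 1).
  (* The empty graph is not maximal: [line] properly contains it. *)
  case: A0e => // A0; have := Amax _ _ good_line; case.
  rewrite A0; split=> [//|h]; have := h (e, 1); apply.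
  by exists 1; rewrite scale1r.
have AZ a x r : A (x, r) -> A (a *: x, a * r).
  move=> Ax; have A00 : A (0, 0).
    by have := Alin (-1) _ _ _ _ Ax Ax; rewrite scaleN1r mulN1r !addNr.
  by have := Alin a _ _ _ _ Ax A00; rewrite !addr0.
have AD x y r s : A (x, r) -> A (y, s) -> A (x + y, r + s).
  by move=> Ax Ay; have := Alin 1 _ _ _ _ Ax Ay; rewrite scale1r mul1r.
have AN x r : A (x, r) -> A (- x, - r).
  by move=> /(AZ (-1)); rewrite scaleN1r mulN1r.
have Afun x r s : A (x, r) -> A (x, s) -> r = s.
  move=> Ar As; have h1 := AD _ _ _ _ Ar (AN _ _ As).
  have h2 := AN _ _ h1; rewrite subrr in h1 h2; rewrite oppr0 in h2.
  have := Apos _ _ h1 C0; have := Apos _ _ h2 C0; lra.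
have Atot x : exists r, A (x, r).
  apply: contrapT => nx.
  (* Positivity forces any value at [x] to lie above [L] and below [Up]; a number [v] between the
     two extends the graph and contradicts maximality. *)
  pose L := [set r | exists y, A (y, r) /\ C (x - y)].
  pose Up := [set r | exists y, A (y, r) /\ C (y - x)].
  have LU l u : L l -> Up u -> l <= u.
    move=> [y [Ay Cy]] [z [Az Cz]].
    have Czy : C (z - y) by have := CD Cz Cy; rewrite addrA subrK.
    have := Apos _ _ (AD _ _ _ _ Az (AN _ _ Ay)) Czy; lra.
  have [v [vL vU]] : exists v, (forall l, L l -> l <= v) /\
                               (forall u, Up u -> v <= u).
    (* Subtracting or adding a multiple of [e] given by [Cub] shows that [L] and [Up] are both empty
       or both nonempty. In the first case 0 serves as [v], in the second [sup L]. *)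
    have [[l0 Ll0]|L0] := pselect (L !=set0); last first.
      exists 0; split=> [l Ll|u [z [Az Cz]]]; first by case: L0; exists l.
      have [K CK] := Cub Cz; case: L0; exists (u - K), (z - K *: e); split.
        by apply: AD => //; apply: AN; have := AZ K _ _ Ae; rewrite mulr1.
      by rewrite (_ : x - _ = K *: e - (z - x))// !opprB addrCA.
    have [K [u0 Uu0]] : exists K, Up K.
      case: Ll0 => y [Ay Cy]; have [K CK] := Cub Cy.
      exists (l0 + K), (y + K *: e); split.
        by apply: AD => //; have := AZ K _ _ Ae; rewrite mulr1.
      by rewrite (_ : _ - x = K *: e - (x - y))// opprB addrAC addrC.
    exists (sup L); split=> [l Ll|u Uu].
      apply: ub_le_sup => //; exists K => l' Ll'; apply: LU => //.
      by exists u0.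
    by apply: ge_sup; [exists l0|move=> l Ll; apply: LU].
  pose B := [set z : E * R | exists y r t,
    A (y, r) /\ z = (y + t *: x, r + t * v)].
  apply: (Amax B).
    split=> [[y r] Ay|h].
      by exists y, r, 0; rewrite scale0r mul0r !addr0.
    apply: nx; exists v; apply: h; exists 0, 0, 1.
    rewrite scale1r mul1r !add0r; split=> //.
    by have := AD _ _ _ _ Ae (AN _ _ Ae); rewrite !subrr.
  split.
  - move=> a _ _ _ _ [y [r [t [Ay [-> ->]]]]] [z [s [u [Az [-> ->]]]]].
    exists (a *: y + z), (a * r + s), (a * t + u); split; first exact: Alin.
    congr pair; last by lra.
    by rewrite scalerDr scalerDl scalerA addrACA.
  - move=> _ _ [y [r [t [Ay [-> ->]]]]] Cyt.
    (* Division by [|t|] turns [C (y + t *: x)] into a member of [Up] for negative [t] and of [L]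
       for positive [t]. *)
    have [t0|t0|t0] := ltgtP t 0.
    + have : v <= (- t)^-1 * r.
        apply: vU; exists ((- t)^-1 *: y); split; first exact: AZ.
        have -> : (- t)^-1 *: y - x = (- t)^-1 *: (y + t *: x).
          by rewrite scalerDr scalerA invrN mulNr mulVf ?lt_eqF// scaleN1r.
        by apply: CZ => //; rewrite invr_ge0; lra.
      rewrite ler_pdivlMl; lra.
    + have : - (t^-1 * r) <= v.
        apply: vL; exists (- (t^-1 *: y)); split; first exact/AN/AZ.
        have -> : x - (- (t^-1 *: y)) = t^-1 *: (y + t *: x).
          by rewrite scalerDr scalerA mulVf ?gt_eqF// scale1r opprK addrC.
        by apply: CZ => //; rewrite invr_ge0 ltW.
      rewrite lerNl ler_pdivlMl ?mulrN//; lra.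
    + move: Cyt; rewrite t0 scale0r mul0r !addr0; exact: Apos Ay.
  - by right; exists e, 1, 0; rewrite scale0r mul0r !addr0.
have [phi phiP] := choice Atot.
exists phi; split=> [a x y||x Cx].
- by apply: (Afun (a *: x + y)); [exact: phiP|apply: Alin; exact: phiP].
- exact: Afun (phiP e) Ae.
- exact: Apos (phiP x) Cx.
Qed.

End ConeExtension.

(** * Finitely additive means *)

Section Means.
Variable R : realType.

(** A finitely additive probability carried by [S]. Linearity concerns all functions, but the second
    clause controls only those bounded on [S]; hence the boundedness hypotheses of [mean_le]. With
    [a = b = 0] it shows that only the values on [S] count. *)
Definition mean_on (T : Type) (S : set T) (m : (T -> R) -> R) : Prop :=
  (forall a F F', m (fun s => a * F s + F' s) = a * m F + m F') /\
  (forall F a b, (forall s, S s -> a <= F s <= b) -> a <= m F <= b).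

Definition bounded_on (T : Type) (S : set T) (F : T -> R) : Prop :=
  exists K : R, forall s, S s -> `|F s| <= K.

Section MeanTheory.
Variables (T : Type) (S : set T) (m : (T -> R) -> R).
Hypothesis mm : mean_on S m.

Lemma mean_lin a F F' : m (fun s => a * F s + F' s) = a * m F + m F'.
Proof. exact: mm.1. Qed.

Lemma mean_bound F a b : (forall s, S s -> a <= F s <= b) -> a <= m F <= b.
Proof. exact: mm.2. Qed.

Lemma mean_eq F F' : (forall s, S s -> F s = F' s) -> m F = m F'.
Proof.
move=> h; apply/eqP; rewrite -subr_eq0 addrC -mulN1r -mean_lin eq_le.
have /andP[h1 h2] : 0 <= m (fun s => -1 * F' s + F s) <= 0.
  by apply: mean_bound => s Ss; rewrite mulN1r h// addNr lexx.
by rewrite h1 h2.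
Qed.

Lemma meanD F F' : m (fun s => F s + F' s) = m F + m F'.
Proof.
rewrite -[m F]mul1r -mean_lin; congr m.
by apply/funext => s; rewrite mul1r.
Qed.

Lemma mean_cst c : m (fun=> c) = c.
Proof.
apply/eqP; rewrite eq_le andbC; apply: (@mean_bound (fun=> c) c c) => s _.
by rewrite lexx.
Qed.

Lemma meanZ a F : m (fun s => a * F s) = a * m F.
Proof.
have := mean_lin a F (fun=> 0); rewrite mean_cst addr0 => <-.
by congr m; apply/funext => s; rewrite addr0.
Qed.

Lemma meanN F : m (fun s => - F s) = - m F.
Proof.
by rewrite -mulN1r -meanZ; congr m; apply/funext => s; rewrite mulN1r.
Qed.

Lemma meanB F F' : m (fun s => F s - F' s) = m F - m F'.
Proof. by rewrite meanD meanN. Qed.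

Lemma mean_sum (I : Type) (r : seq I) (P : pred I) (F : I -> T -> R) :
  m (fun s => \sum_(i <- r | P i) F i s) = \sum_(i <- r | P i) m (F i).
Proof.
elim: r => [|i r IH].
  rewrite big_nil -[RHS](mean_cst 0); congr m.
  by apply/funext => s; rewrite big_nil.
rewrite big_cons; case: ifPn => Pi; rewrite -IH -?meanD; congr m;
  by apply/funext => s; rewrite big_cons ?Pi ?(negbTE Pi).
Qed.

Lemma mean_le F F' : bounded_on S F -> bounded_on S F' ->
  (forall s, S s -> F s <= F' s) -> m F <= m F'.
Proof.
move=> [K hK] [K' hK'] h; rewrite -subr_ge0 -meanB.
have /andP[] // : 0 <= m (fun s => F' s - F s) <= K + K'.
apply: mean_bound => s Ss; rewrite subr_ge0 h//=.
move: (hK s Ss) (hK' s Ss); rewrite !ler_norml => /andP[? ?] /andP[? ?]; lra.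
Qed.

Lemma mean_norm F K : (forall s, S s -> `|F s| <= K) -> `|m F| <= K.
Proof.
move=> h; rewrite ler_norml; apply: mean_bound => s /h.
by rewrite ler_norml.
Qed.

End MeanTheory.

Section BoundedOn.
Variables (T : Type) (S : set T).
Implicit Types F : T -> R.

Lemma bounded_cst c : bounded_on S (fun=> c).
Proof. by exists `|c|. Qed.

Lemma boundedD F F' : bounded_on S F -> bounded_on S F' ->
  bounded_on S (fun s => F s + F' s).
Proof.
move=> [K h] [K' h']; exists (K + K') => s Ss.
by rewrite (le_trans (ler_normD _ _))// lerD ?h ?h'.
Qed.

Lemma boundedM F F' : bounded_on S F -> bounded_on S F' ->
  bounded_on S (fun s => F s * F' s).
Proof.
move=> [K h] [K' h']; exists (K * K') => s Ss.
by rewrite normrM ler_pM ?h ?h'.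
Qed.

Lemma boundedN F : bounded_on S F -> bounded_on S (fun s => - F s).
Proof. by move=> [K h]; exists K => s Ss; rewrite normrN h. Qed.

Lemma boundedB F F' : bounded_on S F -> bounded_on S F' ->
  bounded_on S (fun s => F s - F' s).
Proof. by move=> bF /boundedN; exact: boundedD. Qed.

Lemma bounded_norm F : bounded_on S F -> bounded_on S (fun s => `|F s|).
Proof. by move=> [K h]; exists K => s Ss; rewrite normr_id h. Qed.

Lemma bounded_sum (I : Type) (r : seq I) (P : pred I) (F : I -> T -> R) :
  (forall i, P i -> bounded_on S (F i)) ->
  bounded_on S (fun s => \sum_(i <- r | P i) F i s).
Proof.
move=> h; elim: r => [|i r [K IH]].
  by exists 0 => s _; rewrite big_nil normr0.
have [Pi|Pi] := boolP (P i); last first.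
  by exists K => s Ss; rewrite big_cons (negbTE Pi) IH.
have [K' h'] := h i Pi.
exists (K' + K) => s Ss; rewrite big_cons Pi.
by rewrite (le_trans (ler_normD _ _))// lerD ?IH ?h'.
Qed.

End BoundedOn.

(** * Invariant means on commutative semigroups *)

Section InvariantMean.
Variables (G : Type) (op : G -> G -> G) (g0 : G).
Hypotheses (opA : associative op) (opC : commutative op).

(* Functions whose averages over finitely many translates are
   asymptotically nonnegative. *)
Let cone : set (G -> R^o) := [set F | bounded_on setT F /\
  forall eps : R, 0 < eps -> exists W : seq G, (0 < size W)%N /\
    forall s, - eps * (size W)%:R <= \sum_(w <- W) F (op s w)].

Let cone0 : cone 0.
Proof.
split; first exact: (bounded_cst setT 0).
move=> eps e0; exists [:: g0]; split => // s; rewrite big_seq1 /=.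
by rewrite mulr1 oppr_le0 ltW.
Qed.

Let coneD F F' : cone F -> cone F' -> cone (F + F').
Proof.
move=> [bF hF] [bF' hF']; split; first exact: boundedD.
move=> eps e0; have e2 : 0 < eps / 2 by rewrite divr_gt0.
have [W [W0 hW]] := hF _ e2; have [W' [W0' hW']] := hF' _ e2.
(* Translating by all products of [W] and [W'] averages [F] over [W] at points moved by [W'], and
   [F'] over [W'] at points moved by [W]; commutativity makes both readings possible. *)
exists (allpairs op W W'); rewrite size_allpairs muln_gt0 W0 W0'; split=> // s.
have -> : \sum_(w <- allpairs op W W') (F + F') (op s w) =
   \sum_(w' <- W') \sum_(w <- W) F (op (op s w') w) +
   \sum_(w <- W) \sum_(w' <- W') F' (op (op s w) w').
  rewrite big_allpairs_dep exchange_big /= [X in _ = _ + X]exchange_big -big_split /=.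
  apply: eq_bigr => w' _; rewrite -big_split; apply: eq_bigr => w _ /=.
  by rewrite fctE -!opA (opC w' w).
have h1 : - (eps / 2) * (size W)%:R * (size W')%:R <=
    \sum_(w' <- W') \sum_(w <- W) F (op (op s w') w).
  rewrite mulr_natr -(sum1_size W') -sumrMnr; apply: ler_sum => w' _.
  by rewrite mulr1n hW.
have h2 : - (eps / 2) * (size W')%:R * (size W)%:R <=
    \sum_(w <- W) \sum_(w' <- W') F' (op (op s w) w').
  rewrite mulr_natr -(sum1_size W) -sumrMnr; apply: ler_sum => w _.
  by rewrite mulr1n hW'.
rewrite natrM; move: h1 h2; lra.
Qed.

Let coneZ (a : R) F : 0 <= a -> cone F -> cone (a *: F).
Proof.
rewrite le_eqVlt => /predU1P[<- _|a0 [bF hF]]; first by rewrite scale0r.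
split; first by apply: boundedM => //; exact: bounded_cst.
move=> eps e0; have [W [W0 hW]] := hF _ (divr_gt0 e0 a0).
exists W; split=> // s; rewrite -mulr_sumr.
rewrite -ler_pdivrMl//; apply: le_trans (hW s).
by rewrite mulrA mulrN (mulrC a^-1).
Qed.

Let coneN1 : ~ cone (- (fun=> 1)).
Proof.
move=> [_ /(_ 2^-1)]; rewrite invr_gt0 ltr0n => /(_ isT) [W [W0 /(_ g0)]].
rewrite (eq_bigr (fun=> -1)) // big_const_seq count_predT iter_addr_0 mulNrn.
have : 0 < (size W)%:R :> R by rewrite ltr0n.
by move=> ? ?; lra.
Qed.

Let cone_ub F : cone F -> exists K : R, cone (K *: (fun=> 1) - F).
Proof.
move=> [bF _]; have [K hK] := bF; exists K; split.
  by apply: boundedB => //; apply: boundedM; exact: bounded_cst.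
move=> eps e0; exists [:: g0]; split=> // s; rewrite big_seq1 mulr1.
rewrite -[X in _ <= X]/(K * 1 - F (op s g0)).
by have := hK (op s g0) Logic.I; rewrite ler_norml => /andP[? ?]; lra.
Qed.

(** A functional that is nonnegative on [cone] is invariant, because both [F (op s w) - F s] and its
    opposite lie in [cone]: their sums over the powers of [w] telescope. *)
Lemma invariant_mean : exists m : (G -> R) -> R, mean_on setT m /\
  forall F w, bounded_on setT F -> m (fun s => F (op s w)) = m F.
Proof.
have [m [mlin m1 mpos]] := cone_extension cone0 coneD coneZ coneN1 cone_ub.
have mpos' (F : G -> R^o) : bounded_on setT F -> (forall s, 0 <= F s) -> 0 <= m F.
  move=> bF F0; apply: mpos; split=> // eps e0; exists [:: g0]; split=> // s.
  by rewrite big_seq1 mulr1 (le_trans _ (F0 _))// oppr_le0 ltW.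
have lin a F F' : m (fun s => a * F s + F' s) = a * m F + m F' by exact: mlin.
have mm : mean_on setT m.
  split=> // F a b h.
  have bF : bounded_on setT F.
    exists (`|a| + `|b|) => s _; have /andP[h1 h2] := h s Logic.I.
    have := ler_norm b; have := ler_norm (- a); rewrite normrN ler_norml.
    have := normr_ge0 a; have := normr_ge0 b; lra.
  have h1 : 0 <= m (fun s => (- a) * 1 + F s).
    apply: mpos' => [|s]; first by apply: boundedD => //; exact: bounded_cst.
    by have /andP[] := h s Logic.I; lra.
  have h2 : 0 <= m (fun s => -1 * F s + b * 1).
    apply: mpos' => [|s]; last by have /andP[] := h s Logic.I; lra.
    apply: boundedD; last exact: bounded_cst.
    by apply: boundedM => //; exact: bounded_cst.
  have mb : m (fun=> b * 1) = b.
    have := lin b (fun=> 1) (fun=> 0).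
    have -> : m (fun=> 0) = 0.
      by have := lin (-1) (fun=> 0) (fun=> 0); rewrite mulr0 addr0; lra.
    rewrite m1 => h0; transitivity (b * 1 + 0); last by lra.
    by rewrite -h0; congr m; apply/funext => s; lra.
  by move: h1 h2; rewrite !lin m1 mb; lra.
exists m; split=> // F w [K hK].
have K0 : 0 <= K by apply: le_trans (hK g0 Logic.I).
have key (a : R) : `|a| <= 1 -> cone (fun s => a * (F (op s w) - F s)).
  move=> a1; split.
    exists (`|a| * (K + K)) => s _; rewrite normrM ler_wpM2l//.
    by rewrite (le_trans (ler_normB _ _))// lerD ?hK.
  (* [pw i] is the power of [w] with exponent [i + 1]. The telescoped sum is at most [K + K] in
     absolute value, and [N] is large enough for [eps * N] to exceed this. *)
  move=> eps e0; pose pw i := iter i (op w) w.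
  pose N := (Num.truncn ((K + K) / eps)).+1.
  exists [seq pw i | i <- index_iota 0 N]; rewrite size_map size_iota subn0.
  split=> // s; rewrite big_map.
  have -> : \sum_(i <- index_iota 0 N) a * (F (op (op s (pw i)) w) - F (op s (pw i)))
       = a * (F (op s (pw N)) - F (op s (pw 0%N))).
    rewrite -mulr_sumr -(telescope_sumr (fun i => F (op s (pw i))))//.
    congr (_ * _); apply: eq_bigr => i _.
    by rewrite -opA [op (pw i) w]opC.
  have hN : (K + K) < eps * N%:R.
    by rewrite mulrC -ltr_pdivrMr// truncnS_gt.
  rewrite mulNr lerNl -[leLHS]mulNr.
  have : `| - a * (F (op s (pw N)) - F (op s (pw 0%N)))| <= 1 * (K + K).
    rewrite normrM normrN ler_pM//.
    by rewrite (le_trans (ler_normB _ _))// lerD ?hK.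
  rewrite ler_norml => /andP[_ h]; lra.
have h1 := mpos _ (key 1 _); have h2 := mpos _ (key (-1) _).
rewrite normrN normr1 lexx in h1 h2.
by have := h2 isT; have := h1 isT; rewrite !(meanZ mm) !(meanB mm); lra.
Qed.

End InvariantMean.

End Means.

(** * Means on the unit interval *)

Section UnitIntervalMean.
Variable R : realType.

Definition banach_limit : (nat -> R) -> R :=
  sval (cid (invariant_mean R 0%N addnA addnC)).

Lemma banach_limit_mean : mean_on setT banach_limit.
Proof. by rewrite /banach_limit; case: cid => m []. Qed.

Lemma banach_limit_shift F w : bounded_on setT F ->
  banach_limit (fun s => F (s + w)%N) = banach_limit F.
Proof. by rewrite /banach_limit; case: cid => m [_ h] /= /h. Qed.

(** Shift invariance allows the first [w] terms to be dropped, after which the error is at most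
    [K / w.+1]. *)
Lemma banach_limit_cvg F l K :
  (forall n, `|F n - l| <= K / n.+1%:R) -> banach_limit F = l.
Proof.
move=> h; have mm := banach_limit_mean.
have K0 : 0 <= K by have := h 0%N; rewrite divr1; apply: le_trans.
have hw w : `|banach_limit F - l| <= K / w.+1%:R.
  rewrite -(@banach_limit_shift F w); last first.
    exists (`|l| + K) => s _; rewrite -(subrK l (F s)) addrC.
    rewrite (le_trans (ler_normD _ _))// lerD2l (le_trans (h s))//.
    by rewrite ler_pdivrMr// ler_peMr// ler1n.
  rewrite -{1}(mean_cst mm l) -(meanB mm); apply: (mean_norm mm) => s _.
  by rewrite (le_trans (h _))// ler_wpM2l// lef_pV2 ?posrE// ler_nat ltnS leq_addl.
apply/eqP; rewrite -subr_eq0 -normr_le0 leNgt; apply/negP => d0.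
have := hw (Num.truncn (K / `|banach_limit F - l|)).
apply/negP; rewrite -ltNge ltr_pdivrMr// mulrC -ltr_pdivrMr//.
exact: truncnS_gt.
Qed.

Definition itv01 : set R := [set t | 0 <= t <= 1].

(** A Banach limit of left Riemann sums: the integral over the unit interval wherever those sums
    converge, yet defined for every function. *)
Definition unif (F : R -> R) : R := banach_limit
  (fun N => N.+1%:R^-1 * \sum_(j < N.+1) F (j%:R / N.+1%:R)).

Lemma unif_mean : mean_on itv01 unif.
Proof.
have mm := banach_limit_mean; split=> [a F F'|F a b h].
  rewrite -(mean_lin mm); congr banach_limit; apply/funext => N.
  by rewrite big_split -mulr_sumr mulrDr mulrCA.
apply: (mean_bound mm) => N _.
have NE (c : R) : c = N.+1%:R^-1 * \sum_(j < N.+1) c.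
  by rewrite sumr_const card_ord -(mulr_natl c) mulrA mulVf ?mul1r// pnatr_eq0.
have hj (j : 'I_N.+1) : itv01 (j%:R / N.+1%:R).
  rewrite /itv01 /= divr_ge0 ?ler0n//= ler_pdivrMr// mul1r ler_nat ltnW//.
by rewrite {1}(NE a) {1}(NE b) !ler_pM2l ?invr_gt0// !ler_sum// => j _;
  have /andP[] := h _ (hj j).
Qed.

(** A derivative with a uniform quadratic remainder. Over a mesh of [M] intervals the errors add up
    to at most [K / M], which is the rate [banach_limit_cvg] asks for. *)
Definition primitive (G F : R -> R) : Prop := exists K : R, forall t h : R,
  0 <= t -> 0 <= h -> t + h <= 1 -> `|G (t + h) - G t - h * F t| <= K * h ^+ 2.

Lemma unif_primitive G F : primitive G F -> unif F = G 1 - G 0.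
Proof.
move=> [K hK]; apply: (@banach_limit_cvg _ _ K) => N.
set M := N.+1%:R : R; have M0 : 0 < M by rewrite ltr0n.
have -> : G 1 - G 0 =
    \sum_(0 <= j < N.+1) (G (j.+1%:R / M) - G (j%:R / M)).
  by rewrite (telescope_sumr (fun j => G (j%:R / M)))// mul0r divff// gt_eqF.
rewrite big_mkord mulr_sumr -sumrB (le_trans (ler_norm_sum _ _ _))//.
have -> : K / M = \sum_(j < N.+1) K * M^-1 ^+ 2.
  rewrite sumr_const card_ord -[RHS]mulr_natr -/M.
  by rewrite expr2 -!mulrA mulVf ?mulr1// gt_eqF.
apply: ler_sum => j _; rewrite distrC.
have -> : j.+1%:R / M = j%:R / M + M^-1 by rewrite -natr1 mulrDl mul1r.
apply: hK; rewrite ?divr_ge0 ?invr_ge0 ?ler0n//.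
rewrite -[X in _ + X]div1r -mulrDl natr1 ler_pdivrMr// mul1r ler_nat.
exact: ltn_ord.
Qed.

Lemma poly_bounded (p : {poly R}) : bounded_on itv01 (fun t => p.[t]).
Proof.
exists (\sum_(i < size p) `|p`_i|) => t /andP[t0 t1].
rewrite horner_coef (le_trans (ler_norm_sum _ _ _))//; apply: ler_sum => i _.
rewrite normrM -[leRHS]mulr1 ler_wpM2l// normrX ger0_norm//.
by rewrite exprn_ile1.
Qed.

Lemma poly_primitive (p : {poly R}) :
  primitive (fun t => p.[t]) (fun t => p^`().[t]).
Proof.
elim/poly_ind: p => [|p c [K IH]].
  by exists 0 => t h _ _ _; rewrite deriv0 !horner0 mulr0 !subr0 normr0 mul0r.
have [K' hK'] := poly_bounded p^`().
exists (K + (K + K')) => t h t0 h0 th.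
have t1 : t <= 1 by lra.
have h1 : h <= 1 by lra.
have K0 : 0 <= K.
  have := le_trans (normr_ge0 _) (IH 0 1 (lexx _) ler01 _).
  by rewrite expr1n mulr1 add0r; apply.
rewrite derivMXaddC !hornerMXaddC hornerD hornerM hornerX [p.[t] + _]addrC.
(* With [r] the remainder of [p], the remainder of [p * 'X + c] is [t r + h (r + h p'(t))]. Since
   [t] and [h] are at most 1, the two terms cost [K h^2] and [(K + K') h^2]. *)
have -> : p.[t + h] * (t + h) + c - (p.[t] * t + c)
    - h * (p^`().[t] * t + p.[t]) =
  t * (p.[t + h] - p.[t] - h * p^`().[t]) +
  h * ((p.[t + h] - p.[t] - h * p^`().[t]) + h * p^`().[t]) by ring.
have IHt := IH t h t0 h0 th.
rewrite mulrDl (le_trans (ler_normD _ _))// lerD//.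
  rewrite normrM (ger0_norm t0) (le_trans _ IHt)//.
  by rewrite -[leRHS]mul1r ler_wpM2r.
rewrite normrM (ger0_norm h0).
have -> : (K + K') * h ^+ 2 = h * (K * h + K' * h) by ring.
rewrite ler_wpM2l// (le_trans (ler_normD _ _))// lerD//.
  rewrite (le_trans IHt)// expr2 mulrA -[leRHS]mulr1 ler_wpM2l//.
  exact: mulr_ge0.
rewrite normrM (ger0_norm h0) mulrC ler_wpM2r//.
by apply: hK'; rewrite /itv01 /= t0.
Qed.

(** As the derivative vanishes at [a], cutting it off below [a] keeps the remainder quadratic: an
    increment across [a] is compared with the shorter one that starts at [a]. This integrates the
    positive part of [t - a]. *)
Lemma primitive_truncated (p : {poly R}) a : 0 <= a <= 1 -> p^`().[a] = 0 ->
  primitive (fun t => p.[Num.max t a]) (fun t => if a <= t then p^`().[t] else 0).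
Proof.
move=> /andP[a0 a1] pa; have [K hK] := poly_primitive p.
have K0 : 0 <= K.
  have := le_trans (normr_ge0 _) (hK 0 1 (lexx _) ler01 _).
  by rewrite expr1n mulr1 add0r; apply.
exists K => t h t0 h0 th.
have [at_|ta] := leP a t; first by rewrite max_l ?hK//; lra.
have [ath|tha] := leP a (t + h).
  have := hK a (t + h - a); rewrite pa !mulr0 !subr0.
  have -> : a + (t + h - a) = t + h by ring.
  move=> hh.
  rewrite (le_trans (hh _ _ _))//; first lra.
  rewrite ler_wpM2l// lerXn2r ?nnegrE//; lra.
by rewrite subrr mulr0 subr0 normr0 mulr_ge0// exprn_ge0.
Qed.

Lemma fact_neq0 n : n`!%:R != 0 :> R.
Proof. by rewrite pnatr_eq0 -lt0n fact_gt0. Qed.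

(** Euler's beta integral, by induction on [b]: integration by parts through the derivative of
    ['X^(a.+1) * (1 - 'X) ^+ b.+1], which vanishes at both ends. *)
Lemma unif_beta a b : unif (fun t => t ^+ a * (1 - t) ^+ b) =
  a`!%:R * b`!%:R / (a + b)%N.+1`!%:R.
Proof.
have mm := unif_mean.
have uP (p : {poly R}) : unif (fun t => p^`().[t]) = p.[1] - p.[0].
  exact: unif_primitive (poly_primitive p).
elim: b a => [|b IH] a.
  have := uP (a.+1%:R^-1 *: 'X^(a.+1)).
  rewrite !hornerE expr1n expr0n /= mulr0 subr0 mulr1 => E.
  rewrite factS natrM invfM mulrCA divff ?mulr1; last first.
    exact: fact_neq0.
  rewrite -E; congr unif; apply/funext => t.
  rewrite derivZ derivXn hornerZ hornerMn hornerXn mulr1 -(mulr_natl (t ^+ _)).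
  by rewrite mulrA mulVf ?mul1r// pnatr_eq0.
have := uP ('X^(a.+1) * (1 - 'X) ^+ b.+1).
rewrite !hornerE /= !expr0n /= subrr !expr0n /= mulr0 mul0r subrr.
have -> : (fun t => ('X^(a.+1) * (1 - 'X) ^+ b.+1)^`().[t]) =
   (fun t : R => a.+1%:R * (t ^+ a * (1 - t) ^+ b.+1) +
     (- b.+1%:R * (t ^+ a.+1 * (1 - t) ^+ b))).
  apply/funext => t; rewrite derivM derivXn deriv_exp.
  by rewrite !derivE !(hornerE, hornerMn) /=; ring.
rewrite (meanD mm) !(meanZ mm) IH => E.
have {E} E : unif (fun t => t ^+ a * (1 - t) ^+ b.+1) =
    a.+1%:R^-1 * (b.+1%:R * (a.+1`!%:R * b`!%:R / (a.+1 + b)%N.+1`!%:R)).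
  move: E; set u := unif _ => E; apply: (@mulfI _ a.+1%:R); first by rewrite pnatr_eq0.
  by rewrite mulVKf ?pnatr_eq0//; lra.
rewrite {}E addSnnS [a.+1`!]factS [b.+1`!]factS.
rewrite (natrM _ a.+1 a`!) (natrM _ b.+1 b`!).
have a0 : a.+1%:R != 0 :> R by rewrite pnatr_eq0.
have f0 := fact_neq0 (a + b.+1).+1.
move: a0 f0; move: (a.+1%:R : R) (b.+1%:R : R) ((a + b.+1)%N.+1`!%:R : R).
by move=> x y f x0 f0; field; rewrite x0 f0.
Qed.

(** Expectation under the Beta(1, k) law, the law of the squared modulus of one coordinate on the
    unit sphere of C^(k+1). *)
Definition betamean k (F : R -> R) : R :=
  unif (fun t => k%:R * (1 - t) ^+ k.-1 * F t).

Lemma betamean_monomial k j l : (0 < k)%N ->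
  betamean k (fun t => t ^+ j * (1 - t) ^+ l) =
  k%:R * (j`!%:R * (l + k.-1)%N`!%:R / (j + l + k)%N`!%:R).
Proof.
move=> k0; rewrite /betamean -(addnA j) -[in (l + k)%N](prednK k0) addnS addnS.
rewrite -unif_beta -(meanZ unif_mean); congr unif; apply/funext => t.
by rewrite exprD; ring.
Qed.

Lemma betamean_mean k : (0 < k)%N -> mean_on itv01 (betamean k).
Proof.
move=> k0; have mm := unif_mean.
have one : betamean k (fun=> 1) = 1.
  have := betamean_monomial 0 0 k0; rewrite !add0n fact0 mul1r.
  have -> : (fun t : R => t ^+ 0 * (1 - t) ^+ 0) = fun=> 1.
    by apply/funext => t; rewrite mulr1.
  move=> ->; rewrite -[in k`!](prednK k0) factS (prednK k0) natrM.
  have := fact_neq0 k.-1; have : k%:R != 0 :> R by rewrite pnatr_eq0 -lt0n.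
  by move: (k%:R : R) (k.-1`!%:R : R) => x y x0 y0; field; rewrite x0 y0.
have lin a F F' :
    betamean k (fun s => a * F s + F' s) = a * betamean k F + betamean k F'.
  rewrite -(mean_lin mm); congr unif; apply/funext => t; ring.
have pos F : bounded_on itv01 F -> (forall t, itv01 t -> 0 <= F t) ->
    0 <= betamean k F.
  move=> bF F0; rewrite -[leLHS](mean_cst mm 0); apply: (mean_le mm).
  - exact: bounded_cst.
  - apply: boundedM => //; have := poly_bounded (k%:R *: (1 - 'X) ^+ k.-1).
    by move=> [K hK]; exists K => s /hK; rewrite !hornerE.
  - move=> t t01; rewrite mulr_ge0 ?F0// mulr_ge0// exprn_ge0//.
    by case/andP: t01; lra.
split=> // F a b h.
have bF : bounded_on itv01 F.
  exists (`|a| + `|b|) => s s01; have /andP[h1 h2] := h s s01.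
  have := ler_norm b; have := ler_norm (- a); rewrite normrN ler_norml.
  have := normr_ge0 a; have := normr_ge0 b; lra.
have Bc c : betamean k (fun=> c) = c.
  have z : betamean k (fun=> 0) = 0.
    by have := lin (-1) (fun=> 0) (fun=> 0); rewrite mulr0 addr0; lra.
  by have := lin c (fun=> 1) (fun=> 0); rewrite one z !addr0 mulr1.
have := pos (fun t => -1 * F t + b).
have := pos (fun t => 1 * F t + (- a)).
rewrite !lin !Bc => h1 h2; apply/andP; split.
  suff : 0 <= 1 * betamean k F - a by lra.
  apply: h1; last by move=> t /h /andP[]; lra.
  by apply: boundedD; [apply: boundedM|]; rewrite //; apply: bounded_cst.
suff : 0 <= -1 * betamean k F + b by lra.
apply: h2; last by move=> t /h /andP[]; lra.
by apply: boundedD; [apply: boundedM|]; rewrite //; apply: bounded_cst.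
Qed.

(** The moment of order [d] of [|<z, x>|^2] for [z] uniform on the unit sphere of C^n and [x] a unit
    vector. *)
Definition moment n d : R := ('C((d + n.-1)%N, d))%:R^-1.

Lemma momentE n d : moment n d = d`!%:R * n.-1`!%:R / (d + n.-1)%N`!%:R.
Proof.
rewrite /moment -(bin_fact (leq_addr n.-1 d)) addKn natrM.
rewrite natrM; have := fact_neq0 d; have := fact_neq0 n.-1.
have : ('C((d + n.-1)%N, d))%:R != 0 :> R by rewrite pnatr_eq0 -lt0n bin_gt0 leq_addr.
move: ('C(_, _)%:R : R) (d`!%:R : R) (n.-1`!%:R : R) => x y z x0 y0 z0.
by field; rewrite x0 y0 z0.
Qed.

Lemma betamean_moment k d : (0 < k)%N ->
  betamean k (fun t => t ^+ d) = moment k.+1 d.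
Proof.
move=> k0; have := betamean_monomial d 0 k0; rewrite add0n addn0 momentE /=.
have -> : (fun t : R => t ^+ d * (1 - t) ^+ 0) = fun t => t ^+ d.
  by apply/funext => t; rewrite mulr1.
move=> ->; rewrite -[in k`!](prednK k0) factS (prednK k0) natrM; ring.
Qed.

(** With [a = 1/(n+1)], the absolute value is twice the positive part [(n+1)(t - a)^+] minus
    [(n+1)t - 1]; the mean of the latter is a first moment, that of the former comes from a
    truncated primitive. *)
Lemma betamean_abs n : (2 <= n)%N ->
  n%:R * betamean n.-1 (fun t => `|n.+1%:R * t - 1|) =
  2 * n%:R * (n%:R / n.+1%:R) ^+ n.-1 - 1 :> R.
Proof.
case: n => [|[|k]]// _; set n := k.+2; rewrite /=.
have k0 : (0 < k.+1)%N by [].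
have mm := betamean_mean k0.
set N := n.+1%:R : R; have N0 : 0 < N by rewrite ltr0n.
have NE : N = n%:R + 1 by rewrite /N -natr1.
have n0 : 0 < n%:R :> R by rewrite ltr0n.
pose a : R := N^-1.
have a01 : 0 <= a <= 1.
  by rewrite invr_ge0 ltW//= invf_le1// ler1n.
(* An antiderivative of [(t - a)] times the Beta density, found by integration by parts. It vanishes
   at 1 and equals [- (1 - a)^n / n] at [a]. *)
pose p : {poly R} := - (('X - a%:P) * (1 - 'X) ^+ k.+1) - n%:R^-1 *: (1 - 'X) ^+ n.
have dp t : p^`().[t] = k.+1%:R * (1 - t) ^+ k * (t - a).
  have dq m : ((1 - 'X : {poly R}) ^+ m)^`().[t] = - m%:R * (1 - t) ^+ m.-1.
    by rewrite deriv_exp hornerMn hornerM !derivE !hornerE -mulr_natl; ring.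
  rewrite /p derivB derivN derivZ derivM derivB derivX derivC subr0 mul1r.
  rewrite hornerD !hornerN hornerZ hornerD hornerM !dq horner_exp hornerXsubC.
  rewrite hornerD hornerN hornerX -(polyC1 R) hornerC !mulNr !mulrN.
  by rewrite mulKf ?gt_eqF//=; ring.
have pos : betamean k.+1 (fun t => if a <= t then t - a else 0) = (1 - a) ^+ n / n%:R.
  have := unif_primitive (primitive_truncated a01 _ : primitive (fun t => p.[_]) _).
  rewrite dp subrr mulr0 => /(_ erefl).
  have /andP[a0 a1] := a01; rewrite (max_l a1) (max_r a0).
  have pE t : p.[t] = - ((t - a) * (1 - t) ^+ k.+1) - n%:R^-1 * (1 - t) ^+ n.
    rewrite /p hornerD !hornerN hornerM hornerXsubC hornerZ !horner_exp.
    by rewrite !hornerD !hornerN !hornerX -(polyC1 R) !hornerC.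
  have -> : p.[1] - p.[a] = (1 - a) ^+ n / n%:R.
    by rewrite !pE !subrr !expr0n /= mulr0 mul0r mulr0; ring.
  move=> <-; congr unif; apply/funext => t.
  by case: ifP; rewrite ?mulr0// dp.
have -> : (fun t => `|N * t - 1|) =
   (fun t => (2 * N) * (if a <= t then t - a else 0) + (-1 * (N * t ^+ 1 + (-1)))).
  apply/funext => t; have Na : N * a = 1 by rewrite divff// gt_eqF.
  have [at_|ta] := leP a t.
    rewrite ger0_norm; last by rewrite subr_ge0 -Na ler_pM2l.
    have -> : 2 * N * (t - a) = 2 * (N * t - N * a) by ring.
    by rewrite Na; ring.
  rewrite ltr0_norm; last by rewrite subr_lt0 -[ltRHS]Na ltr_pM2l.
  ring.
rewrite (mean_lin mm) pos (meanZ mm) (mean_lin mm) (mean_cst mm).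
rewrite betamean_moment// /moment bin1 add1n /=.
have -> : 1 - a = n%:R / N by rewrite /a NE; field; rewrite -NE gt_eqF.
have -> : (n%:R / N) ^+ n = n%:R / N * (n%:R / N) ^+ k.+1 by rewrite -exprS.
rewrite -/n; move: ((n%:R / N) ^+ k.+1) => w.
move: NE N0 n0; move: (N) (n%:R : R) => x y -> x0 y0.
by field; rewrite !gt_eqF.
Qed.

End UnitIntervalMean.

(** * Bernstein approximation of Lipschitz functions *)

Section PolynomialApproximation.
Variable R : realType.

(** The value at [t] is the expectation of [f(S)] for [S] binomial with parameters [N] and [t]; the
    recursion conditions on one trial. Here [f] is indexed by the count, so sampling at [k / N] is
    left to the user. *)
Fixpoint bernstein N (f : nat -> R) : {poly R} :=
  if N is M.+1 then 'X * bernstein M (fun k => f k.+1) + (1 - 'X) * bernstein M f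
  else (f 0%N)%:P.

Lemma bernsteinE N f t : (bernstein N.+1 f).[t] =
  t * (bernstein N (fun k => f k.+1)).[t] + (1 - t) * (bernstein N f).[t].
Proof.
rewrite [bernstein _ _]/= hornerD !hornerM hornerX hornerD hornerN hornerX.
by rewrite -(polyC1 R) hornerC.
Qed.

Lemma bernstein_le N f g (t : R) : 0 <= t <= 1 -> (forall k, f k <= g k) ->
  (bernstein N f).[t] <= (bernstein N g).[t].
Proof.
move=> /andP[t0 t1]; elim: N f g => [|N IH] f g h; first by rewrite !hornerC.
by rewrite !bernsteinE lerD// ler_wpM2l ?IH//; lra.
Qed.

Lemma bernstein_lin N a b f t :
  (bernstein N (fun k => a * f k + b)).[t] = a * (bernstein N f).[t] + b.
Proof.
elim: N f => [|N IH] f; first by rewrite !hornerC.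
by rewrite !bernsteinE !IH; ring.
Qed.

Lemma bernstein_cst N (b t : R) : (bernstein N (fun=> b)).[t] = b.
Proof.
by elim: N => [|N IH]; [rewrite hornerC|rewrite bernsteinE !IH; ring].
Qed.

Lemma bernstein_variance N (c t : R) :
  (bernstein N (fun k => (k%:R - c) ^+ 2)).[t] =
  (N%:R * t - c) ^+ 2 + N%:R * t * (1 - t).
Proof.
elim: N c => [|N IH] c; first by rewrite hornerC; ring.
rewrite bernsteinE IH.
have -> : (fun k => (k.+1%:R - c) ^+ 2) = fun k => (k%:R - (c - 1)) ^+ 2.
  by apply/funext => k; rewrite -natr1; ring.
by rewrite IH -natr1; ring.
Qed.

(** Bernstein's argument: the binomial variance controls the distance of [k / N] from [t].
    Positivity of the operator gives the second conclusion, that bounds on [F] are inherited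
    exactly, which yields test polynomials with [|q| <= 1]. *)
Lemma lipschitz_poly_approx (F : R -> R) (L eps : R) : 0 < eps -> 0 <= L ->
  (forall x y, `|F x - F y| <= L * `|x - y|) ->
  exists q : {poly R}, forall t : R, 0 <= t <= 1 -> `|q.[t] - F t| <= eps /\
    forall c : R, (forall x, `|F x| <= c) -> `|q.[t]| <= c.
Proof.
move=> e0 L0 hF; pose del : R := eps / (2 * (L + 1)).
have d0 : 0 < del by rewrite divr_gt0//; lra.
pose N := (Num.truncn (del ^- 2)).+1; have N0 : 0 < N%:R :> R by rewrite ltr0n.
have hN : (N%:R * del)^-1 <= del.
  have h : 1 <= N%:R * del ^+ 2.
    by rewrite -ler_pdivrMr ?exprn_gt0// div1r ltW// truncnS_gt.
  have Nd := mulr_gt0 N0 d0.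
  by rewrite -(ler_pM2l Nd) divff ?gt_eqF// -mulrA -expr2.
exists (bernstein N (fun k => F (k%:R / N%:R))) => t t01; split; last first.
  move=> c hc; rewrite ler_norml -{1}(bernstein_cst N (- c) t).
  rewrite -{2}(bernstein_cst N c t) !bernstein_le// => k;
    by have := hc (k%:R / N%:R); rewrite ler_norml => /andP[].
(* For [a = 1] and [a = -1], a quadratic majorant and minorant of [F (k / N)], from
   [u <= u^2 / del + del] with [u = |k / N - t|]. Their Bernstein values are explicit. *)
pose g (a : R) (k : nat) := a * (L / del / N%:R ^+ 2) * (k%:R - N%:R * t) ^+ 2 + (a * (L * del) + F t).
have gE a : (bernstein N (g a)).[t] =
    a * (L * (del + t * (1 - t) * (N%:R * del)^-1)) + F t.
  rewrite /g bernstein_lin bernstein_variance subrr expr0n add0r.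
  by field; rewrite !gt_eqF.
have key k : `|F (k%:R / N%:R) - F t| <= L / del / N%:R ^+ 2 * (k%:R - N%:R * t) ^+ 2 + L * del.
  rewrite (le_trans (hF _ _))//.
  have -> : L / del / N%:R ^+ 2 * (k%:R - N%:R * t) ^+ 2 + L * del =
     L * (`|k%:R / N%:R - t| ^+ 2 / del + del).
    rewrite real_normK ?num_real//; field; rewrite !gt_eqF//.
  rewrite ler_wpM2l//; move: (`|_|) (normr_ge0 (k%:R / N%:R - t)) => u u0.
  rewrite -(ler_pM2r d0) mulrDl divfK ?gt_eqF// -subr_ge0.
  have := sqr_ge0 (u - del); have : 0 <= u * del by rewrite mulr_ge0// ltW.
  by nra.
have tt : 0 <= t * (1 - t) <= 1 by case/andP: t01 => ? ?; nra.
have bound : L * (del + t * (1 - t) * (N%:R * del)^-1) <= eps.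
  have le1 : t * (1 - t) * (N%:R * del)^-1 <= del.
    case/andP: tt => ? ?; apply: le_trans hN.
    by rewrite -[leRHS]mul1r ler_wpM2r// invr_ge0 mulr_ge0// ltW.
  have -> : eps = (L + 1) * (del + del) by rewrite /del; field; rewrite gt_eqF//; lra.
  have := ler_wpM2l L0 le1; move: d0; clear; clearbody del.
  by move: (t * (1 - t) / (N%:R * del)) => v ? ?; lra.
have h1 : (bernstein N (fun k => F (k%:R / N%:R))).[t] <= (bernstein N (g 1)).[t].
  apply: bernstein_le => // k; have := key k; rewrite /g ler_norml !mul1r; lra.
have h2 : (bernstein N (g (-1))).[t] <= (bernstein N (fun k => F (k%:R / N%:R))).[t].
  apply: bernstein_le => // k; have := key k; rewrite /g ler_norml !mulN1r !mulNr; lra.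
by move: h1 h2; rewrite !gE ler_norml; lra.
Qed.

(** A Lipschitz substitute for the sign: applied to [y / del] it loses at most [del] against [|y|],
    by [clamp_mul]. *)
Definition clamp (y : R) : R := if y <= -1 then -1 else if 1 <= y then 1 else y.

Lemma clamp_norm y : `|clamp y| <= 1.
Proof.
by rewrite /clamp ler_norml; case: (leP y (-1)) => ?; [|case: (leP 1 y) => ?]; lra.
Qed.

Lemma clamp_lip y y' : `|clamp y - clamp y'| <= `|y - y'|.
Proof.
rewrite /clamp ler_norml; have := ler_norm (y - y'); have := ler_norm (y' - y).
rewrite (distrC y' y); move: `|y - y'| => d; case: (leP y (-1)) => ?;
  case: (leP y' (-1)) => ?; try (case: (leP 1 y) => ?);
  by try (case: (leP 1 y') => ?); lra.
Qed.

Lemma clamp_mul y : `|y| - 1 <= y * clamp y.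
Proof.
rewrite /clamp; case: (leP y (-1)) => ?; first by rewrite ltr0_norm; lra.
case: (leP 1 y) => ?; first by rewrite ger0_norm; lra.
by case: (ger0P y) => ?; nra.
Qed.

End PolynomialApproximation.

(** * The uniform mean on a complex sphere *)

Section SphereMean.
Variable R : realType.
Local Notation C := R[i].
Local Notation Re := (@complex.Re R).
Local Notation Im := (@complex.Im R).

Definition sqn (z : C) : R := Re z ^+ 2 + Im z ^+ 2.

Lemma sqnE z : sqn z = Re (z * conjc z).
Proof. by case: z => a b; rewrite /sqn /=; ring. Qed.

Lemma sqn_ge0 z : 0 <= sqn z.
Proof. by rewrite addr_ge0 ?sqr_ge0. Qed.

Lemma sqnC z : (sqn z)%:C%C = z * conjc z.
Proof. by case: z => a b; rewrite /sqn /=; congr (_ +i* _)%C; ring. Qed.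

Lemma sqnM z w : sqn (z * w) = sqn z * sqn w.
Proof. by case: z w => [a b] [c d]; rewrite /sqn /=; ring. Qed.

Lemma sqnJ z : sqn (conjc z) = sqn z.
Proof. by case: z => a b; rewrite /sqn /=; ring. Qed.

Lemma sqnR (x : R) : sqn x%:C%C = x ^+ 2.
Proof. by rewrite /sqn /=; ring. Qed.

Lemma sqnX z n : sqn (z ^+ n) = sqn z ^+ n.
Proof.
by elim: n => [|n IH]; rewrite ?exprS ?sqnM ?IH// !expr0 /sqn /=; ring.
Qed.

Lemma ReD z w : Re (z + w) = Re z + Re w.
Proof. by case: z w => [a b] [c d]. Qed.

Lemma ReZ (x : R) z : Re (x%:C%C * z) = x * Re z.
Proof. by case: z => a b /=; ring. Qed.

Lemma Re_sum (I : Type) (r : seq I) (P : pred I) (F : I -> C) :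
  Re (\sum_(i <- r | P i) F i) = \sum_(i <- r | P i) Re (F i).
Proof. exact: (big_morph Re ReD erefl). Qed.

Definition circle : Type := {w : C | sqn w == 1}.

Definition circle_mul (u v : circle) : circle.
Proof.
exists (val u * val v); abstract by
  rewrite sqnM (eqP (valP u)) (eqP (valP v)) mulr1.
Defined.

Definition circle1 : circle.
Proof. by exists 1; abstract by rewrite /sqn /= expr0n addr0 expr1n. Defined.

Lemma circle_mulA : associative circle_mul.
Proof. by move=> u v w; apply: val_inj; rewrite /= mulrA. Qed.

Lemma circle_mulC : commutative circle_mul.
Proof. by move=> u v; apply: val_inj; rewrite /= mulrC. Qed.

(** An invariant mean of the circle group, in the role of Haar measure. *)
Definition phase (F : C -> R) : R :=
  sval (cid (invariant_mean R circle1 circle_mulA circle_mulC))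
    (fun w => F (val w)).

Lemma phase_mean : mean_on [set w | sqn w = 1] phase.
Proof.
rewrite /phase; case: cid => m [mm _] /=; split=> [a F F'|F a b h].
  exact: mean_lin mm _ _ _.
by apply: (mean_bound mm) => -[w w1] _; apply: h; exact/eqP.
Qed.

Lemma phase_invariant F u : bounded_on [set w | sqn w = 1] F -> sqn u = 1 ->
  phase (fun w => F (w * u)) = phase F.
Proof.
move=> [K hK] /eqP u1; rewrite /phase; case: cid => m [_ inv] /=.
have := inv (fun w => F (val w)) (exist _ u u1 : circle); apply.
by exists K => -[w w1] _; apply: hK; exact/eqP.
Qed.

Lemma exists_rootN1 k : (0 < k)%N -> exists2 u : C, sqn u = 1 & u ^+ k = -1.
Proof.
move=> k0; pose u : C := k.-root (-1).
have uk : u ^+ k = -1 by exact: rootCK.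
exists u => //; have : sqn u ^+ k = 1 ^+ k.
  by rewrite -sqnX uk expr1n /sqn /=; ring.
by move/eqP; rewrite eqrXn2 ?ler01 ?sqn_ge0// => /eqP.
Qed.

(** For [j] different from [l], rotation by a [u] whose power of exponent [|j - l|] is -1 changes
    the sign of the monomial but not its mean. *)
Lemma phase_monomial c j l :
  phase (fun w => Re (c * (w ^+ j * conjc w ^+ l))) = if j == l then Re c else 0.
Proof.
have pm := phase_mean.
case: eqP => [->|/eqP jl].
  rewrite -[RHS](mean_cst pm); apply: (mean_eq pm) => w /= w1.
  by rewrite -exprMn -sqnC w1 expr1n mulr1.
have [u u1 huv] : exists2 u, sqn u = 1 & u ^+ j * conjc u ^+ l = -1.
  have uJ u : sqn u = 1 -> u * conjc u = 1 by move=> u1; rewrite -sqnC u1.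
  have [jl'|lj] := ltnP j l.
    have lj : (0 < l - j)%N by rewrite subn_gt0.
    have [u u1 uk] := exists_rootN1 lj; exists u => //.
    rewrite -(subnKC (ltnW jl')) exprD mulrA -exprMn uJ// expr1n mul1r.
    by rewrite -rmorphXn uk rmorphN1.
  have lj' : (0 < j - l)%N by rewrite subn_gt0 ltn_neqAle eq_sym jl.
  have [u u1 uk] := exists_rootN1 lj'.
  exists u => //; rewrite -(subnKC lj) exprD mulrAC -exprMn uJ// expr1n mul1r.
  exact: uk.
have : phase (fun w => Re (c * (w ^+ j * conjc w ^+ l))) =
    - phase (fun w => Re (c * (w ^+ j * conjc w ^+ l))).
  rewrite -(meanN pm) -[LHS](phase_invariant _ u1); last first.
    exists (sqn c + 1) => w /= w1; set v := w ^+ j * _.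
    have v1 : sqn (c * v) = sqn c by rewrite !sqnM !sqnX sqnJ w1 !expr1n !mulr1.
    rewrite ler_norml; move: v1; rewrite /sqn; move: (c * v) => d hd.
    have := sqr_ge0 (Im d); have := sqr_ge0 (Re d - 1); have := sqr_ge0 (Re d + 1).
    by nra.
  apply: (mean_eq pm) => w _; rewrite rmorphM !exprMn mulrACA huv mulrN1.
  by rewrite mulrN; case: (c * _).
by lra.
Qed.

(** Expanding [(a + w b)^d] times its conjugate, only the diagonal terms survive the average; this
    squares the binomial coefficients. *)
Lemma phase_sqn_expand a b d : phase (fun w => sqn (a + w * b) ^+ d) =
  \sum_(j < d.+1) ('C(d, j) ^ 2)%:R * (sqn a ^+ (d - j) * sqn b ^+ j).
Proof.
have pm := phase_mean.
pose cf (j l : nat) : C := a ^+ (d - j) * conjc a ^+ (d - l) *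
  (b ^+ j * conjc b ^+ l) *+ ('C(d, j) * 'C(d, l)).
rewrite (mean_eq pm (F' := fun w => \sum_(j < d.+1) \sum_(l < d.+1)
   Re (cf j l * (w ^+ j * conjc w ^+ l)))); last first.
  move=> w _; rewrite -sqnX sqnE rmorphXn rmorphD rmorphM !exprDn.
  rewrite big_distrlr /= Re_sum; apply: eq_bigr => j _; rewrite Re_sum.
  apply: eq_bigr => l _; congr Re; rewrite /cf !exprMn.
  rewrite [LHS]mulrnAl [in LHS]mulrnAr -[LHS]mulrnA [RHS]mulrnAl mulnC.
  congr (_ *+ _).
  by ring.
rewrite (mean_sum pm); apply: eq_bigr => j _.
rewrite (mean_sum pm) (bigD1 j)//= phase_monomial eqxx big1 ?addr0; last first.
  move=> l lj; rewrite phase_monomial ifF//; apply/negbTE.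
  by rewrite eq_sym.
have -> : cf j j = ('C(d, j) ^ 2)%:R%:C%C * ((sqn a)%:C%C ^+ (d - j) * (sqn b)%:C%C ^+ j).
  by rewrite /cf !sqnC !exprMn -mulr_natl rmorph_nat expnS expn1; ring.
by rewrite -!rmorphXn -rmorphM ReZ.
Qed.

(** Adds a last coordinate of squared modulus [t] and phase [w]. Vectors are sequences, so that all
    dimensions share one type; dimension [k + 1] reads the coordinates up to [k]. *)
Definition ext k (t : R) (w : C) (z : nat -> C) (i : nat) : C :=
  if i == k then (Num.sqrt t)%:C%C * w else (Num.sqrt (1 - t))%:C%C * z i.

(* The uniform measure on the unit sphere of C^(k+1): the squared modulus of
   the last coordinate is Beta(1, k)-distributed, its phase is uniform, and
   the remaining coordinates are uniform on a sphere. *)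
Fixpoint sph k (h : (nat -> C) -> R) : R :=
  if k is k'.+1 then
    betamean k (fun t => sph k' (fun z => phase (fun w => h (ext k t w z))))
  else phase (fun w => h (fun=> w)).

Definition sphere k : set (nat -> C) := [set z | \sum_(i < k.+1) sqn (z i) = 1].

Lemma sphere_ext k t w z : itv01 t -> sqn w = 1 -> sphere k z ->
  sphere k.+1 (ext k.+1 t w z).
Proof.
move=> /andP[t0 t1] w1 hz; rewrite /sphere /= big_ord_recr /= /ext eqxx.
rewrite (eq_bigr (fun i : 'I_k.+1 => (1 - t) * sqn (z i))); last first.
  move=> i _; rewrite ifF; last by rewrite ltn_eqF.
  by rewrite sqnM sqnR sqr_sqrtr// subr_ge0.
by rewrite -mulr_sumr hz sqnM sqnR sqr_sqrtr// w1; ring.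
Qed.

Lemma sph_mean k : mean_on (sphere k) (sph k).
Proof.
have pm := phase_mean.
elim: k => [|k IH].
  split=> [a F F'|F a b h] /=; first exact: mean_lin pm _ _ _.
  by apply: (mean_bound pm) => w w1; apply: h; rewrite /sphere /= big_ord1.
have bm := betamean_mean R (ltn0Sn k).
split=> [a F F'|F a b h] /=.
  rewrite -(mean_lin bm); congr betamean; apply/funext => t.
  rewrite -(mean_lin IH); congr sph; apply/funext => z.
  exact: mean_lin pm _ _ _.
apply: (mean_bound bm) => t t01; apply: (mean_bound IH) => z zS.
by apply: (mean_bound pm) => w w1; apply: h; exact: sphere_ext.
Qed.

Definition dot k (z x : nat -> C) : C := \sum_(i < k.+1) z i * conjc (x i).

Definition nrm2 k (x : nat -> C) : R := \sum_(i < k.+1) sqn (x i).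

(** All the unitary invariance used later is contained here, as the right-hand side depends on [x]
    only through its norm. Induction on [k]: the phase average, the smaller sphere and the beta
    integrals turn the expansion into the binomial theorem for [nrm2 k x + y]. *)
Lemma sph_moment k x d :
  sph k (fun z => sqn (dot k z x) ^+ d) = moment R k.+1 d * nrm2 k x ^+ d.
Proof.
have pm := phase_mean.
elim: k d => [|k IH] d.
  rewrite /sph /moment addn0 binn invr1 mul1r /nrm2 big_ord1.
  rewrite -[RHS](mean_cst pm); apply: (mean_eq pm) => w /= w1.
  by rewrite /dot big_ord1 sqnM w1 mul1r sqnJ.
have bm := betamean_mean R (ltn0Sn k); have sm := sph_mean k.
pose y := sqn (x k.+1).
rewrite [LHS]/= (mean_eq bm (F' := fun t => \sum_(j < d.+1)
   (('C(d, j) ^ 2)%:R * y ^+ j * (moment R k.+1 (d - j) * nrm2 k x ^+ (d - j))) *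
   (t ^+ j * (1 - t) ^+ (d - j)))); last first.
  move=> t /andP[t0 t1].
  have E z w : sqn (dot k.+1 (ext k.+1 t w z) x) =
      sqn ((Num.sqrt (1 - t))%:C%C * dot k z x +
           w * ((Num.sqrt t)%:C%C * conjc (x k.+1))).
    congr sqn; rewrite /dot big_ord_recr /= /ext eqxx mulr_sumr; congr (_ + _).
      by apply: eq_bigr => i _; rewrite ifF ?mulrA// ltn_eqF.
    by ring.
  have -> : (fun z => phase (fun w => sqn (dot k.+1 (ext k.+1 t w z) x) ^+ d)) =
    fun z => \sum_(j < d.+1) ('C(d, j) ^ 2)%:R * ((1 - t) ^+ (d - j) * (t * y) ^+ j) *
       (sqn (dot k z x) ^+ (d - j)).
    apply/funext => z; under [in LHS]eq_fun do rewrite E.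
    rewrite phase_sqn_expand; apply: eq_bigr => j _.
    by rewrite !sqnM !sqnR !sqr_sqrtr ?subr_ge0// sqnJ -/y !exprMn; ring.
  rewrite (mean_sum sm); apply: eq_bigr => j _.
  by rewrite (meanZ sm) IH exprMn; ring.
have -> : nrm2 k.+1 x = nrm2 k x + y by rewrite /nrm2 big_ord_recr.
clearbody y; rewrite (mean_sum bm) exprDn mulr_sumr.
apply: eq_bigr => j _; have jd : (j <= d)%N by rewrite -ltnS.
rewrite (meanZ bm) betamean_monomial// subnKC// -/y !momentE /=.
rewrite -(bin_fact jd) factS expnS expn1 !natrM -[_ *+ 'C(_, _)]mulr_natl.
rewrite addnS.
have := fact_neq0 R (d - j + k); have := fact_neq0 R (d + k).+1.
move: ((d - j + k)%N`!%:R : R) ((d + k)%N.+1`!%:R : R) => f g g0 f0.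
by field; rewrite f0 g0.
Qed.

End SphereMean.

(** * Mixed moments on the sphere *)

Section SphereMoments.
Variable R : realType.
Local Notation C := R[i].
Local Notation Re := (@complex.Re R).
Local Notation Im := (@complex.Im R).
Implicit Types (x y z : nat -> C).

Lemma nrm2_ge0 k x : 0 <= nrm2 k x.
Proof. by apply: sumr_ge0 => i _; exact: sqn_ge0. Qed.

Lemma sqn_sub_scale (a b c : C) :
  sqn (a - c * b) = sqn a - 2 * Re (conjc c * (a * conjc b)) + sqn c * sqn b.
Proof.
by case: a b c => [a a'] [b b'] [c c']; rewrite /sqn /=; ring.
Qed.

Lemma sqn_add_scale (a b : C) (s : R) :
  sqn (a + s%:C%C * b) = sqn a + 2 * Re (a * conjc b) * s + sqn b * s ^+ 2.
Proof. by case: a b => [a a'] [b b']; rewrite /sqn /=; ring. Qed.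

Lemma conjc_addscale (a b : C) (s : R) :
  conjc (a + s%:C%C * b) = conjc a + s%:C%C * conjc b.
Proof.
by case: a b => [a a'] [b b']; apply/eqP; rewrite eq_complex /=; apply/andP;
  split; apply/eqP; ring.
Qed.

(** The vector [z - <z, x> x] has nonnegative squared norm. *)
Lemma bessel k z x : nrm2 k x = 1 -> sqn (dot k z x) <= nrm2 k z.
Proof.
move=> x1; have := nrm2_ge0 k (fun i => z i - dot k z x * x i).
rewrite {1}/nrm2; under eq_bigr do rewrite sqn_sub_scale.
rewrite big_split sumrB -!mulr_sumr -Re_sum -mulr_sumr -!/(nrm2 k _) -/(dot k z x).
by rewrite x1 [conjc _ * _]mulrC -sqnC /= mulr1; lra.
Qed.

Lemma sqn_dot_itv k z x : sphere k z -> nrm2 k x = 1 ->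
  0 <= sqn (dot k z x) <= 1.
Proof. by move=> zS x1; rewrite sqn_ge0 -[leRHS]zS bessel. Qed.

Lemma betamean_poly k (q : {poly R}) : (0 < k)%N ->
  betamean k (fun t => q.[t]) = \sum_(i < size q) q`_i * moment R k.+1 i.
Proof.
move=> k0; have bm := betamean_mean R k0.
have -> : (fun t => q.[t]) = fun t => \sum_(i < size q) q`_i * t ^+ i.
  by apply/funext => t; rewrite horner_coef.
rewrite (mean_sum bm); apply: eq_bigr => i _.
by rewrite (meanZ bm) betamean_moment.
Qed.

Lemma sph_poly k x (q : {poly R}) : nrm2 k x = 1 ->
  sph k (fun z => q.[sqn (dot k z x)]) = \sum_(i < size q) q`_i * moment R k.+1 i.
Proof.
move=> x1; have sm := @sph_mean R k.
have -> : (fun z => q.[sqn (dot k z x)]) =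
    fun z => \sum_(i < size q) q`_i * sqn (dot k z x) ^+ i.
  by apply/funext => t; rewrite horner_coef.
rewrite (mean_sum sm); apply: eq_bigr => i _.
by rewrite (meanZ sm) sph_moment x1 expr1n mulr1.
Qed.

(** Both means have the same moments, so they agree on polynomials; a uniform polynomial
    approximation of [F] does the rest. *)
Lemma sph_lipschitz k x (F : R -> R) (L : R) : (0 < k)%N -> nrm2 k x = 1 -> 0 <= L ->
  (forall s t, `|F s - F t| <= L * `|s - t|) ->
  sph k (fun z => F (sqn (dot k z x))) = betamean k F.
Proof.
move=> k0 x1 L0 hF; apply/eqP; rewrite -subr_eq0 -normr_le0 leNgt.
set d := `|_|; apply/negP => d0.
have e0 : 0 < d / 3 by rewrite divr_gt0.
have [q hq] := lipschitz_poly_approx e0 L0 hF.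
have bm := betamean_mean R k0; have sm := @sph_mean R k.
have h1 : `|sph k (fun z => q.[sqn (dot k z x)]) -
            sph k (fun z => F (sqn (dot k z x)))| <= d / 3.
  rewrite -(meanB sm); apply: (mean_norm sm) => z zS.
  by have [] := hq _ (sqn_dot_itv zS x1).
have h2 : `|betamean k (fun t => q.[t]) - betamean k F| <= d / 3.
  by rewrite -(meanB bm); apply: (mean_norm bm) => t /hq[].
move: h1 h2; rewrite (sph_poly _ x1) (betamean_poly _ k0) => h1 h2.
have : d <= d / 3 + d / 3.
  rewrite {1}/d (le_trans (ler_distD _ _ _) (lerD _ h2))//.
  by rewrite distrC.
lra.
Qed.

Lemma coef_trinomial (u v w : R) D (p := (u%:P + v *: 'X + w *: 'X^2) ^+ D) :
  [/\ p`_0 = u ^+ D, p`_1 = D%:R * u ^+ D.-1 * v &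
      p`_2 = D%:R * u ^+ D.-1 * w + 'C(D, 2)%:R * u ^+ D.-2 * v ^+ 2].
Proof.
rewrite {}/p; set t := _ + _ + _.
have t0 : t`_0 = u by rewrite !(coefD, coefZ, coefC, coefX, coefXn) /=; ring.
have t1 : t`_1 = v by rewrite !(coefD, coefZ, coefC, coefX, coefXn) /=; ring.
have t2 : t`_2 = w by rewrite !(coefD, coefZ, coefC, coefX, coefXn) /=; ring.
elim: D => [|D [IH0 IH1 IH2]].
  by rewrite expr0 !coef1 /= !mul0r addr0.
rewrite exprS !coefM !big_ord_recr !big_ord0 /= IH0 IH1 IH2 t0 t1 t2.
rewrite !add0r; split; first by rewrite exprS.
  by case: D {IH0 IH1 IH2} => [|D] /=; rewrite ?exprS -?natr1; ring.
rewrite binS bin1 natrD.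
case: D {IH0 IH1 IH2} => [|[|D]].
- by rewrite bin_small//=; ring.
- by rewrite bin_small//=; ring.
- by move: ('C(D.+2, 2)%:R : R) => c; rewrite /= !exprS; ring.
Qed.

Lemma poly_vanish (p : {poly R}) : (forall s, p.[s] = 0) -> p = 0.
Proof.
move=> h; apply: (@roots_geq_poly_eq0 _ p [seq i%:R | i <- iota 0 (size p)]).
- by apply/allP => s _; apply/rootP.
- by rewrite map_inj_uniq ?iota_uniq// => i j /eqP; rewrite eqr_nat => /eqP.
- by rewrite size_map size_iota.
Qed.

(* Comparing the coefficients of [s^2] in the moment formula at [x + s y]. *)
Lemma sph_second_order k x y D (a := fun z => dot k z x) (b := fun z => dot k z y) :
  sph k (fun z => D%:R * sqn (a z) ^+ D.-1 * sqn (b z) +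
    'C(D, 2)%:R * sqn (a z) ^+ D.-2 * (2 * Re (a z * conjc (b z))) ^+ 2) =
  moment R k.+1 D * (D%:R * nrm2 k x ^+ D.-1 * nrm2 k y +
    'C(D, 2)%:R * nrm2 k x ^+ D.-2 * (2 * Re (dot k x y)) ^+ 2).
Proof.
have sm := @sph_mean R k.
pose p (u v w : R) : {poly R} := (u%:P + v *: 'X + w *: 'X^2) ^+ D.
pose pz z := p (sqn (a z)) (2 * Re (a z * conjc (b z))) (sqn (b z)).
pose px := p (nrm2 k x) (2 * Re (dot k x y)) (nrm2 k y).
pose N := (2 * D)%N.+3.
have szp u v w : (size (p u v w) <= N)%N.
  have sz : (size (u%:P + v *: 'X + w *: 'X^2 : {poly R})%R <= 3)%N.
    rewrite (leq_trans (size_polyD _ _))// geq_max.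
    rewrite (leq_trans (size_polyD _ _)) ?geq_max ?size_polyC_leq1//=.
      rewrite (leq_trans (size_scale_leq _ _))// size_polyXn//.
    rewrite (leq_trans (size_polyC_leq1 _))//.
    by rewrite (leq_trans (size_scale_leq _ _))// size_polyX.
  rewrite (leq_trans (size_poly_exp_leq _ _))// /N ltnS.
  rewrite leqW// leqW//; apply: leq_mul => //.
  by rewrite -subn1 leq_subLR.
have hp u v w s : (p u v w).[s] = (u + v * s + w * s ^+ 2) ^+ D.
  by rewrite /p horner_exp !hornerD !hornerZ hornerC hornerX hornerXn.
(* The moment formula holds for every real [s], and linearity of the mean makes each side a
   polynomial in [s]; hence the coefficients agree. *)
have key : \poly_(i < N) (sph k (fun z => (pz z)`_i) - moment R k.+1 D * px`_i) = 0.
  apply: poly_vanish => s; rewrite horner_poly.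
  have := sph_moment k (fun i => x i + s%:C%C * y i) D.
  have -> : (fun z => sqn (dot k z (fun i => x i + s%:C%C * y i)) ^+ D) =
      fun z => \sum_(i < N) s ^+ i * (pz z)`_i.
    apply/funext => z; under eq_bigr do rewrite mulrC.
    rewrite -horner_coef_wide ?szp// hp -sqn_add_scale; congr (sqn _ ^+ _).
    rewrite /a /b /dot mulr_sumr -big_split; apply: eq_bigr => i _ /=.
    by rewrite conjc_addscale; ring.
  have -> : nrm2 k (fun i => x i + s%:C%C * y i) ^+ D = px.[s].
    rewrite hp; congr (_ ^+ _); rewrite /nrm2.
    under eq_bigr do rewrite sqn_add_scale.
    by rewrite /dot Re_sum mulr_sumr !mulr_suml -!big_split.
  rewrite (mean_sum sm) (horner_coef_wide _ (szp _ _ _)) mulr_sumr => E.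
  under eq_bigr do rewrite mulrBl -mulrA.
  rewrite sumrB -E; apply/eqP; rewrite subr_eq0; apply/eqP.
  by apply: eq_bigr => i _; rewrite (meanZ sm) mulrC.
have := congr1 (fun q : {poly R} => q`_2) key; rewrite coef_poly coef0 /=.
have [_ _ e2] := coef_trinomial (nrm2 k x) (2 * Re (dot k x y)) (nrm2 k y) D.
rewrite -/(p _ _ _) -/px in e2; rewrite e2 => /eqP; rewrite subr_eq0 => /eqP <-.
congr sph; apply/funext => z.
by have [_ _ <-] := coef_trinomial (sqn (a z)) (2 * Re (a z * conjc (b z))) (sqn (b z)) D.
Qed.

Lemma bin2R d : 2 * 'C(d.+1, 2)%:R = d.+1%:R * d%:R :> R.
Proof.
elim: d => [|d IH]; first by rewrite bin_small// !mulr0.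
by rewrite binS bin1 natrD mulrDr IH -!natr1; ring.
Qed.

(** Adding the second-order identities for [y] and for [i y] removes the phases, because the squares
    of [2 Re c] and [2 Re (- i c)] add up to [4 |c|^2]. *)
Lemma sph_mixed k x y d : nrm2 k x = 1 ->
  sph k (fun z => sqn (dot k z x) ^+ d * sqn (dot k z y)) =
  moment R k.+1 d.+1 / d.+1%:R * (nrm2 k y + d%:R * sqn (dot k x y)).
Proof.
move=> x1; have sm := @sph_mean R k.
have h1 := sph_second_order k x y d.+1.
have h2 := sph_second_order k x (fun i => 'i%C * y i) d.+1.
have dotI z : dot k z (fun i => 'i%C * y i) = - 'i%C * dot k z y.
  rewrite /dot mulr_sumr; apply: eq_bigr => i _.
  by rewrite rmorphM /=; case: (z i) (y i) => [? ?] [? ?] /=; congr (_ +i* _)%C; ring.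
have nI : nrm2 k (fun i => 'i%C * y i) = nrm2 k y.
  by apply: eq_bigr => i _; rewrite sqnM {1}/sqn /=; ring.
rewrite nI x1 !expr1n in h1 h2.
have sI (c : C) : (2 * Re c) ^+ 2 + (2 * Re (- 'i%C * c)) ^+ 2 = 4 * sqn c.
  by case: c => c c'; rewrite /sqn /=; ring.
have := congr2 +%R h1 h2; rewrite -(meanD sm) -mulrDr.
rewrite dotI.
have -> : d.+1%:R * 1 * nrm2 k y + 'C(d.+1, 2)%:R * 1 * (2 * Re (dot k x y)) ^+ 2 +
    (d.+1%:R * 1 * nrm2 k y + 'C(d.+1, 2)%:R * 1 * (2 * Re (- 'i%C * dot k x y)) ^+ 2)
  = 2 * d.+1%:R * (nrm2 k y + d%:R * sqn (dot k x y)).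
  rewrite addrACA -[X in _ + X = _]mulrDr sI.
  by have := bin2R d; move: ('C(d.+1, 2)%:R : R) => c hc; nra.
move=> E.
have -> : sph k (fun z => sqn (dot k z x) ^+ d * sqn (dot k z y)) =
   (2 * d.+1%:R * d.+1%:R)^-1 * sph k (fun z => 2 * d.+1%:R * d.+1%:R * (sqn (dot k z x) ^+ d * sqn (dot k z y))).
  rewrite (meanZ sm) mulKf// !mulf_neq0// pnatr_eq0.
rewrite (_ : sph k _ = moment R k.+1 d.+1 * (2 * d.+1%:R * (nrm2 k y + d%:R * sqn (dot k x y)))).
  have : d.+1%:R != 0 :> R by rewrite pnatr_eq0.
  by move: (d.+1%:R : R) => D D0; field.
rewrite -E; congr sph; apply/funext => z; rewrite dotI sqnM.
have -> : sqn (- 'i%C : C) = 1 by rewrite /sqn /=; ring.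
set a := dot k z x; set b := dot k z y.
have -> : a * conjc (- 'i%C * b) = - (- 'i%C * (a * conjc b)).
  by case: a b => [? ?] [? ?] /=; congr (_ +i* _)%C; ring.
have -> : (2 * Re (- (- 'i%C * (a * conjc b)))) ^+ 2 =
    4 * (sqn a * sqn b) - (2 * Re (a * conjc b)) ^+ 2.
  rewrite -[sqn b]sqnJ -sqnM -sI.
  by case: (a * conjc b) => [? ?] /=; ring.
have := bin2R d; move: (sqn a) (sqn b) ('C(d.+1, 2)%:R : R) => X W c hc.
have -> : d.+1%:R * X ^+ d.+1.-1 * W + c * X ^+ d.+1.-2 * (2 * Re (a * conjc b)) ^+ 2 +
  (d.+1%:R * X ^+ d.+1.-1 * (1 * W) +
   c * X ^+ d.+1.-2 * (4 * (X * W) - (2 * Re (a * conjc b)) ^+ 2)) =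
  2 * d.+1%:R * X ^+ d * W + 2 * (2 * c) * (X ^+ d.-1 * X) * W by rewrite /=; ring.
by rewrite hc; case: (d) => [|e] /=; rewrite -?exprSr -?natr1; ring.
Qed.

End SphereMoments.

(** * Self-adjoint matrices and their quadratic forms *)

Section QuadraticForms.
Variables (R : realType) (k : nat).
Local Notation C := R[i].
Local Notation Re := (@complex.Re R).
Local Notation Im := (@complex.Im R).
Local Notation n := k.+1.
Implicit Types (A B : 'M[C]_n) (x y z : nat -> C).

Definition mv A z (i : nat) : C := \sum_(j < n) A (inord i) j * z j.

Definition qf A z : R := Re (dot k (mv A z) z).

Lemma qfE A z : qf A z = \sum_(i < n) \sum_(j < n)
  (Re (A i j) * Re (z j * conjc (z i)) - Im (A i j) * Im (z j * conjc (z i))).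
Proof.
rewrite /qf /dot Re_sum; apply: eq_bigr => i _; rewrite /mv inord_val mulr_suml.
rewrite Re_sum; apply: eq_bigr => j _; rewrite -mulrA.
by case: (A i j) (_ * conjc _) => [a b] [c d].
Qed.

Lemma qfD A B z : qf (A + B) z = qf A z + qf B z.
Proof.
rewrite !qfE -big_split; apply: eq_bigr => i _ /=; rewrite -big_split /=.
by apply: eq_bigr => j _; rewrite mxE; case: (A i j) (B i j) => [? ?] [? ?] /=; ring.
Qed.

Lemma qfZ (a : R) A z : qf (a%:C%C *: A) z = a * qf A z.
Proof.
rewrite !qfE mulr_sumr; apply: eq_bigr => i _; rewrite mulr_sumr.
by apply: eq_bigr => j _; rewrite mxE; case: (A i j) => [? ?] /=; ring.
Qed.

Lemma qfN A z : qf (- A) z = - qf A z.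
Proof.
by rewrite -[RHS]mulN1r -qfZ rmorphN1 scaleN1r.
Qed.

Lemma qfB A B z : qf (A - B) z = qf A z - qf B z.
Proof. by rewrite qfD qfN. Qed.

Lemma qf_adj A z : qf (adjmx A) z = qf A z.
Proof.
rewrite !qfE exchange_big; apply: eq_bigr => i _; apply: eq_bigr => j _ /=.
rewrite mxE; case: (A _ _) (z i) (z j) => [? ?] [? ?] [? ?] /=; ring.
Qed.

Lemma qf1 z : qf 1%:M z = nrm2 k z.
Proof.
rewrite qfE; apply: eq_bigr => i _; rewrite (bigD1 i)//= big1 => [|j ji].
  by rewrite mxE eqxx addr0 sqnE /=; case: (z i) => ? ? /=; ring.
by rewrite mxE eq_sym (negbTE ji) /=; ring.
Qed.

Definition outer y : 'M[C]_n := \matrix_(i, j) (y i * conjc (y j)).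

Lemma qf_outer y z : qf (outer y) z = sqn (dot k z y).
Proof.
rewrite sqnE /qf [in RHS]/dot rmorph_sum mulrC mulr_suml; congr Re.
rewrite {1}/dot; apply: eq_bigr => i _; rewrite /mv mulr_suml mulr_sumr.
by apply: eq_bigr => j _; rewrite mxE inord_val /= rmorphM /= conjcK; ring.
Qed.

Lemma selfadj_outer y : selfadj (outer y).
Proof. by apply/matrixP => i j; rewrite !mxE rmorphM /= conjcK mulrC. Qed.

Lemma selfadjD A B : selfadj A -> selfadj B -> selfadj (A + B).
Proof.
move=> hA hB; apply/matrixP => i j; rewrite -[in RHS]hA -[in RHS]hB !mxE.
by rewrite rmorphD.
Qed.

Lemma selfadjZ (a : R) A : selfadj A -> selfadj (a%:C%C *: A).
Proof.
move=> hA; apply/matrixP => i j; rewrite -[in RHS]hA !mxE.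
by case: (A j i) => ? ? /=; apply/eqP; rewrite eq_complex /=; apply/andP;
  split; apply/eqP; ring.
Qed.

Lemma selfadjN A : selfadj A -> selfadj (- A).
Proof.
move=> hA; apply/matrixP => i j; rewrite -[in RHS]hA !mxE.
by rewrite rmorphN.
Qed.

Lemma selfadjB A B : selfadj A -> selfadj B -> selfadj (A - B).
Proof. by move=> hA /selfadjN; exact: selfadjD. Qed.

Lemma selfadj0 : selfadj (0 : 'M[C]_n).
Proof. by apply/matrixP => i j; rewrite !mxE rmorph0. Qed.

Lemma selfadj1 : selfadj (1%:M : 'M[C]_n).
Proof.
by apply/matrixP => i j; rewrite !mxE eq_sym rmorph_nat.
Qed.

Lemma adjmxK A : adjmx (adjmx A) = A.
Proof. by apply/matrixP => i j; rewrite !mxE conjcK. Qed.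

Lemma adjmxD A B : adjmx (A + B) = adjmx A + adjmx B.
Proof. by apply/matrixP => i j; rewrite !mxE rmorphD. Qed.

(* Uses z E_ab + z^* E_ba =
   (z e_a + e_b) (z e_a + e_b)^* - |z|^2 e_a e_a^* - e_b e_b^*. *)
Lemma selfadj_span (psi : 'M[C]_n -> R) :
  (forall A B, psi (A + B) = psi A + psi B) ->
  (forall (a : R) A, psi (a%:C%C *: A) = a * psi A) ->
  (forall y, psi (outer y) = 0) -> forall A, selfadj A -> psi A = 0.
Proof.
move=> psiD psiZ psi0 A hA.
have psi00 : psi 0 = 0 by have := psiZ 0 0; rewrite scaler0 mul0r.
have psi_sum (I : finType) (F : I -> 'M[C]_n) :
    (forall i, psi (F i) = 0) -> psi (\sum_i F i) = 0.
  by move=> h; elim/big_ind: _ => // B B' hB hB'; rewrite psiD hB hB' addr0.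
pose e (a : 'I_n) : nat -> C := fun i => (i == a :> nat)%:R.
have E2 : A + A = \sum_a \sum_b
    (A a b *: delta_mx a b + conjc (A a b) *: delta_mx b a).
  under eq_bigr do rewrite big_split /=.
  rewrite big_split /= -matrix_sum_delta; congr (_ + _).
  rewrite -{1}hA exchange_big [LHS]matrix_sum_delta.
  by apply: eq_bigr => a _; apply: eq_bigr => b _; rewrite mxE.
have T a b : psi (A a b *: delta_mx a b + conjc (A a b) *: delta_mx b a) = 0.
  set z := A a b.
  have -> : z *: delta_mx a b + conjc z *: delta_mx b a =
      outer (fun i => z * e a i + e b i) +
      ((- sqn z)%:C%C *: outer (e a) + (-1)%:C%C *: outer (e b)).
    have -> : (- sqn z)%:C%C = - (z * conjc z) by rewrite rmorphN /= sqnC.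
    rewrite rmorphN1; apply/matrixP => i j.
    rewrite !mxE rmorphD rmorphM !rmorph_nat /= /e !val_eqE.
    by case: (i == a); case: (i == b); case: (j == a); case: (j == b) => /=; ring.
  by rewrite !psiD !psiZ !psi0 !mulr0 !addr0.
have : psi (A + A) = 0 by rewrite E2; apply: (psi_sum) => a; apply: (psi_sum).
by rewrite psiD; lra.
Qed.

Lemma nrm2Z (a : R) z : nrm2 k (fun i => a%:C%C * z i) = a ^+ 2 * nrm2 k z.
Proof.
by rewrite /nrm2 mulr_sumr; apply: eq_bigr => i _; rewrite sqnM sqnR.
Qed.

Lemma qf_scale (a : R) A z : qf A (fun i => a%:C%C * z i) = a ^+ 2 * qf A z.
Proof.
rewrite !qfE mulr_sumr; apply: eq_bigr => i _; rewrite mulr_sumr.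
by apply: eq_bigr => j _; case: (z i) (z j) => [? ?] [? ?] /=; ring.
Qed.

Lemma nrm2_eq0 z : nrm2 k z = 0 -> forall i : 'I_n, z i = 0.
Proof.
move=> z0 i; have : sqn (z i) == 0.
  have := psumr_eq0P (fun j _ => sqn_ge0 (z (nat_of_ord j))) z0 => /(_ i isT) ->.
  exact: eqxx.
rewrite /sqn paddr_eq0 ?sqr_ge0// !sqrf_eq0 => /andP[/eqP h1 /eqP h2].
by move: h1 h2; case: (z i) => a b /= -> ->.
Qed.

Lemma qf_bound A (K : R) : (forall z, sphere k z -> `|qf A z| <= K) ->
  forall z, `|qf A z| <= K * nrm2 k z.
Proof.
move=> h z; have := nrm2_ge0 k z; rewrite le_eqVlt => /predU1P[z0|z0].
  rewrite -z0 mulr0 qfE big1 ?normr0// => i _; rewrite big1// => j _.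
  by rewrite (nrm2_eq0 (esym z0)) mul0r mulr0 mulr0 subr0.
pose a : R := (Num.sqrt (nrm2 k z))^-1.
have a2 : a ^+ 2 = (nrm2 k z)^-1 by rewrite exprVn sqr_sqrtr// ltW.
have aS : sphere k (fun i => a%:C%C * z i).
  by have := nrm2Z a z; rewrite a2 mulVf ?gt_eqF.
have := h _ aS; rewrite qf_scale a2.
by rewrite normrM gtr0_norm ?invr_gt0// mulrC ler_pdivrMr.
Qed.

Lemma qf_polar A x y : selfadj A ->
  qf A (fun i => x i + y i) - qf A (fun i => x i - y i) =
  4 * Re (dot k (mv A x) y).
Proof.
move=> hA.
have sym : Re (dot k (mv A y) x) = Re (dot k (mv A x) y).
  rewrite /dot !Re_sum /mv.
  under eq_bigr do rewrite mulr_suml Re_sum.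
  under [RHS]eq_bigr do rewrite mulr_suml Re_sum.
  rewrite exchange_big; apply: eq_bigr => i _; apply: eq_bigr => j _ /=.
  rewrite !inord_val -[in LHS]hA mxE.
  by case: (A i j) (y i) (x j) => [? ?] [? ?] [? ?] /=; ring.
have -> : 4 * Re (dot k (mv A x) y) =
    2 * Re (dot k (mv A x) y) + 2 * Re (dot k (mv A y) x) by rewrite sym; ring.
rewrite /qf /dot !Re_sum !mulr_sumr -sumrB -big_split; apply: eq_bigr => i _.
have mvE (s : C) : mv A (fun j => x j + s * y j) i = mv A x i + s * mv A y i.
  by rewrite /mv mulr_sumr -big_split; apply: eq_bigr => j _ /=; ring.
have -> : (fun j => x j + y j) = (fun j => x j + 1 * y j).
  by apply/funext => j; rewrite mul1r.
have -> : (fun j => x j - y j) = (fun j => x j + (-1) * y j).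
  by apply/funext => j; rewrite mulN1r.
rewrite !mvE /=.
by case: (mv A x i) (mv A y i) (x i) (y i) => [? ?] [? ?] [? ?] [? ?] /=; ring.
Qed.

Lemma nrm2_parallelogram x y :
  nrm2 k (fun i => x i + y i) + nrm2 k (fun i => x i - y i) =
  2 * (nrm2 k x + nrm2 k y).
Proof.
rewrite /nrm2 -!big_split mulr_sumr; apply: eq_bigr => i _ /=.
by case: (x i) (y i) => [? ?] [? ?]; rewrite /sqn /=; ring.
Qed.

(** Take [w = A x / |A x|]. Polarization gives [4 |A x|] as the difference of the forms at [x + w]
    and [x - w], and the parallelogram law bounds it by [2 K (|x|^2 + 1)], at most [4 K]. *)
Lemma qf_nrm2_mv A (K : R) x : selfadj A ->
  (forall z, sphere k z -> `|qf A z| <= K) -> 0 <= K -> nrm2 k x <= 1 ->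
  Num.sqrt (nrm2 k (mv A x)) <= K.
Proof.
move=> hA /qf_bound h K0 x1; set N := nrm2 k (mv A x).
have := nrm2_ge0 k (mv A x); rewrite -/N le_eqVlt => /predU1P[<-|N0].
  by rewrite sqrtr0.
pose r : R := Num.sqrt N; have r0 : 0 < r by rewrite sqrtr_gt0.
have rN : r ^+ 2 = N by rewrite sqr_sqrtr// ltW.
pose w i := (r^-1)%:C%C * mv A x i.
have w1 : nrm2 k w = 1 by rewrite nrm2Z -/N -rN exprVn mulVf// sqrf_eq0 gt_eqF.
have h1 := h (fun i => x i + w i); have h2 := h (fun i => x i - w i).
have pol := qf_polar x w hA; have par := nrm2_parallelogram x w.
have wr : Re (dot k (mv A x) w) = r.
  rewrite /dot Re_sum (eq_bigr (fun i : 'I_n => r^-1 * sqn (mv A x i))).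
    by rewrite -mulr_sumr -/(nrm2 k (mv A x)) -/N -rN expr2 mulKf// gt_eqF.
  by move=> i _; rewrite /w; case: (mv A x i) => ? ?; rewrite /sqn /=; ring.
rewrite wr in pol; rewrite w1 in par.
move: h1 h2; rewrite !ler_norml => /andP[_ h1] /andP[h2 _].
have : 4 * r <= K * (2 * (nrm2 k x + 1)) by rewrite -par -pol mulrDr; lra.
by have := ler_wpM2l K0 x1; rewrite mulr1 -/r; lra.
Qed.

Lemma sphere0 : sphere k (fun i => (i == 0%N)%:R : C).
Proof.
rewrite /sphere /= big_ord_recl /= big1 ?addr0 => [|i _].
  by rewrite /sqn /= expr0n addr0 expr1n.
by rewrite /sqn /= expr0n addr0.
Qed.

Definition of_cV (v : 'cV[C]_n) : nat -> C := fun i => v (inord i) 0.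

Lemma vnorm_nrm2 (v : 'cV[C]_n) : vnorm v = Num.sqrt (nrm2 k (of_cV v)).
Proof.
by congr Num.sqrt; apply: eq_bigr => i _; rewrite /sqn /of_cV inord_val.
Qed.

Lemma vnorm_mv A (v : 'cV[C]_n) :
  vnorm (A *m v) = Num.sqrt (nrm2 k (mv A (of_cV v))).
Proof.
rewrite vnorm_nrm2; congr Num.sqrt; apply: eq_bigr => i _; congr sqn.
by rewrite /of_cV /mv mxE inord_val; apply: eq_bigr => j _; rewrite inord_val.
Qed.

Lemma nrm2_of_cV (v : 'cV[C]_n) : vnorm v <= 1 -> nrm2 k (of_cV v) <= 1.
Proof.
rewrite vnorm_nrm2 => h; rewrite -[leLHS]sqr_sqrtr ?nrm2_ge0//.
by rewrite expr_le1// sqrtr_ge0.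
Qed.

Lemma opnorm_le_qf A (K : R) : selfadj A ->
  (forall z, sphere k z -> `|qf A z| <= K) -> opnorm A <= K.
Proof.
move=> hA h; have K0 : 0 <= K := le_trans (normr_ge0 _) (h _ sphere0).
apply: ge_sup.
  exists (vnorm (A *m 0)), 0 => //=.
  by rewrite vnorm_nrm2 /nrm2 big1 ?sqrtr0// => i _; rewrite /of_cV mxE /sqn /= expr0n addr0.
by move=> _ [v /= /nrm2_of_cV v1 <-]; rewrite vnorm_mv; apply: qf_nrm2_mv.
Qed.

Lemma qf_bounded A : bounded_on (sphere k) (qf A).
Proof.
suff [K hK] : bounded_on (sphere k) (fun z => \sum_(i < n) \sum_(j < n)
    (Re (A i j) * Re (z j * conjc (z i)) - Im (A i j) * Im (z j * conjc (z i)))).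
  by exists K => z /hK; rewrite qfE.
have bz z (zS : sphere k z) (i : 'I_n) : sqn (z i) <= 1.
  by rewrite -[leRHS]zS (bigD1 i)//= lerDl sumr_ge0// => j _; exact: sqn_ge0.
have bR (c : C) : sqn c <= 1 -> `|Re c| <= 1 /\ `|Im c| <= 1.
  rewrite /sqn => h; rewrite !ler_norml.
  by have := sqr_ge0 (Re c); have := sqr_ge0 (Im c); split; nra.
have bc (i j : 'I_n) z : sphere k z -> sqn (z j * conjc (z i)) <= 1.
  by move=> zS; rewrite sqnM sqnJ mulr_ile1 ?sqn_ge0 ?bz.
apply: bounded_sum => i _; apply: bounded_sum => j _; apply: boundedB.
  apply: boundedM; first exact: bounded_cst.
  by exists 1 => z zS; case: (bR _ (bc i j z zS)).
apply: boundedM; first exact: bounded_cst.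
by exists 1 => z zS; case: (bR _ (bc i j z zS)).
Qed.

Lemma qf_le_opnorm A z : selfadj A -> sphere k z -> `|qf A z| <= opnorm A.
Proof.
move=> hA zS.
pose v : 'cV[C]_n := \col_i z i.
have vz : nrm2 k (of_cV v) = nrm2 k z.
  by apply: eq_bigr => i _; rewrite /of_cV mxE inord_val.
have mvz : nrm2 k (mv A (of_cV v)) = nrm2 k (mv A z).
  apply: eq_bigr => i _; congr sqn; apply: eq_bigr => j _; congr (_ * _).
  by rewrite /of_cV mxE inord_val.
have zz : nrm2 k z = 1 by [].
apply: (@le_trans _ _ (vnorm (A *m v))).
  rewrite vnorm_mv mvz -(@ler_pXn2r _ 2)// ?nnegrE ?sqrtr_ge0//.
  rewrite sqr_sqrtr ?nrm2_ge0// real_normK ?num_real//.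
  by apply: le_trans (bessel (mv A z) zz); rewrite /qf /sqn lerDl sqr_ge0.
apply: ub_le_sup; last by exists v => //=; rewrite vnorm_nrm2 vz zz sqrtr1.
(* The supremum defining [opnorm] dominates its members only once the set is known to be bounded. *)
have [K hK] := qf_bounded A; exists K => _ [w /= /nrm2_of_cV w1 <-].
rewrite vnorm_mv; apply: qf_nrm2_mv => //.
exact: le_trans (normr_ge0 _) (hK _ sphere0).
Qed.

(** The form of [A - B] is bounded by 0 on the sphere, so [qf_nrm2_mv] with [K = 0] kills every
    column. *)
Lemma qf_inj A B : selfadj A -> selfadj B ->
  (forall z, sphere k z -> qf A z = qf B z) -> A = B.
Proof.
move=> hA hB h; apply/eqP; rewrite -subr_eq0; apply/eqP/matrixP => i j.
rewrite [RHS]mxE; set D := A - B; have hD : selfadj D by exact: selfadjB.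
pose e (l : nat) : C := (l == j)%:R.
have e1 : nrm2 k e = 1.
  rewrite /nrm2 (bigD1 j)//= big1 ?addr0 => [|l lj].
    by rewrite /e eqxx /sqn /= expr0n addr0 expr1n.
  by rewrite /e val_eqE (negbTE lj) /sqn /= expr0n addr0.
have : Num.sqrt (nrm2 k (mv D e)) <= 0.
  apply: qf_nrm2_mv; rewrite ?e1// => z zS.
  by rewrite qfB h// subrr normr0.
rewrite -sqrtr0 ler_psqrt ?nnegrE ?nrm2_ge0// => h0.
have /nrm2_eq0 /(_ i) : nrm2 k (mv D e) = 0.
  by apply/eqP; rewrite eq_le h0 nrm2_ge0.
rewrite /mv inord_val (bigD1 j)//= big1 ?addr0 => [|l lj].
  by rewrite /e eqxx mulr1.
by rewrite /e val_eqE (negbTE lj) mulr0.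
Qed.

Definition sph_mx (phi : (nat -> C) -> 'M[C]_n) : 'M[C]_n :=
  \matrix_(i, j) (sph k (fun z => Re (phi z i j)) +i* sph k (fun z => Im (phi z i j)))%C.

Lemma qf_sph_mx phi x : qf (sph_mx phi) x = sph k (fun z => qf (phi z) x).
Proof.
have sm := @sph_mean R k.
rewrite qfE; under [in RHS]eq_fun do rewrite qfE.
rewrite (mean_sum sm); apply: eq_bigr => i _; rewrite (mean_sum sm).
apply: eq_bigr => j _; rewrite mxE /= (meanB sm).
by congr (_ - _); rewrite mulrC -(meanZ sm); congr sph; apply/funext => z;
  rewrite mulrC.
Qed.

Lemma selfadj_sph_mx phi : (forall z, selfadj (phi z)) -> selfadj (sph_mx phi).
Proof.
move=> h; apply/matrixP => i j; rewrite !mxE /= -(meanN (@sph_mean R k)).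
by congr (sph k _ +i* sph k _)%C; apply/funext => z; rewrite -[in RHS]h mxE;
  case: (phi z j i).
Qed.

End QuadraticForms.

(** * The upper bound *)

Section McShane.
Variables (R : realType) (Z : Type) (rho : Z -> Z -> R).
Hypothesis rhoM : is_metric rho.

Definition mcshane (X : set Z) (l : R) (u : Z -> R) (z : Z) : R :=
  inf [set u x + l * rho x z | x in X].

Variables (X : set Z) (x0 : Z) (l : R) (u : Z -> R).
Hypotheses (Xx0 : X x0) (l0 : 0 <= l).
Hypothesis ulip : forall x y, X x -> X y -> `|u x - u y| <= l * rho x y.

Lemma mcshane_lb z : has_inf [set u x + l * rho x z | x in X].
Proof.
have [rho0 _ rhoC rhoT] := rhoM.
split; first by exists (u x0 + l * rho x0 z), x0.
exists (u x0 - l * rho x0 z) => _ [x Xx <-].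
have := ulip Xx0 Xx; rewrite ler_norml => /andP[_ h].
have := ler_wpM2l l0 (rhoT x0 z x); rewrite (rhoC z x) mulrDr; lra.
Qed.

Lemma mcshane_le x z : X x -> mcshane X l u z <= u x + l * rho x z.
Proof. by move=> Xx; apply: ge_inf; [case: (mcshane_lb z)|exists x]. Qed.

Lemma mcshane_ext x : X x -> mcshane X l u x = u x.
Proof.
move=> Xx; have [rho0 rhoE rhoC rhoT] := rhoM.
apply/eqP; rewrite eq_le; apply/andP; split.
  by have := mcshane_le x Xx; rewrite (proj2 (rhoE x x) erefl) mulr0 addr0.
apply: lb_le_inf; first by case: (mcshane_lb x).
move=> _ [y Xy <-]; have := ulip Xx Xy; rewrite (rhoC x y) ler_norml; lra.
Qed.

Lemma mcshane_lip z z' : `|mcshane X l u z - mcshane X l u z'| <= l * rho z z'.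
Proof.
have [rho0 rhoE rhoC rhoT] := rhoM.
have half w w' : mcshane X l u w - l * rho w w' <= mcshane X l u w'.
  apply: lb_le_inf; first by case: (mcshane_lb w').
  move=> _ [y Xy <-]; have := mcshane_le w Xy.
  have := ler_wpM2l l0 (rhoT y w' w); rewrite (rhoC w' w) mulrDr; lra.
rewrite ler_norml; have := half z z'; have := half z' z; rewrite (rhoC z' z); lra.
Qed.

End McShane.

(** * Averaging scalar extensions against a reproducing kernel *)

Section UpperBound.
Variables (R : realType) (k : nat).
Hypothesis k0 : (0 < k)%N.
Local Notation C := R[i].
Local Notation n := k.+1.
Local Notation N := (k.+1%:R : R).
Implicit Types (A B : 'M[C]_n) (x y z : nat -> C).

(** The mean of [|ker x z|] over [z] for a unit vector [x]; [betamean_abs] identifies it with the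
    value claimed. *)
Definition proj_const : R := N * betamean k (fun t => `|n.+1%:R * t - 1|).

Lemma sqn_dotC x y : sqn (dot k x y) = sqn (dot k y x).
Proof.
rewrite -[RHS]sqnJ /dot rmorph_sum; congr sqn; apply: eq_bigr => i _ /=.
by rewrite rmorphM /= conjcK mulrC.
Qed.

Definition ker x y : R := N * (n.+1%:R * sqn (dot k y x) - 1).

Lemma ker_bounded x : nrm2 k x = 1 -> bounded_on (sphere k) (ker x).
Proof.
move=> x1; apply: boundedM; first exact: bounded_cst.
apply: boundedB; last exact: bounded_cst.
apply: boundedM; first exact: bounded_cst.
by exists 1 => z zS; have /andP[? ?] := sqn_dot_itv zS x1; rewrite ger0_norm.
Qed.

Lemma sph_abs_ker x : nrm2 k x = 1 -> sph k (fun z => `|ker x z|) = proj_const.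
Proof.
move=> x1; have sm := @sph_mean R k.
rewrite /proj_const -(sph_lipschitz (L := n.+1%:R) k0 x1 (ler0n _ _)).
  rewrite -(meanZ sm); congr sph; apply/funext => z.
  by rewrite normrM ger0_norm// ler0n.
move=> s t; rewrite (le_trans (ler_dist_dist _ _))//.
by rewrite opprB addrA subrK -mulrBr normrM ger0_norm// ler0n.
Qed.

Lemma moment1 : moment R n 1 = N^-1.
Proof. by rewrite /moment bin1 add1n. Qed.

Lemma moment2 : moment R n 2 = 2 / (N * n.+1%:R).
Proof.
rewrite /moment add2n /=; have := bin2R R n; rewrite mulrC => h.
have N0 : N != 0 by rewrite pnatr_eq0.
have M0 : n.+1%:R != 0 :> R by rewrite pnatr_eq0.
have c0 : ('C(n.+1, 2))%:R != 0 :> R.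
  by rewrite pnatr_eq0 -lt0n bin_gt0.
by apply: (mulfI c0); rewrite divff// mulrA h (mulrC N) divff ?mulf_neq0.
Qed.

(** Both sides are real-linear in [A], so rank-one matrices suffice, and there only the moments of
    orders 1 and 2 enter. *)
Lemma sph_reproducing A x : selfadj A -> nrm2 k x = 1 ->
  sph k (fun z => qf A z * ker x z) = qf A x.
Proof.
move=> hA x1; have sm := @sph_mean R k.
pose psi B := sph k (fun z => qf B z * ker x z) - qf B x.
suff : psi A = 0 by move/eqP; rewrite subr_eq0 => /eqP.
apply: selfadj_span hA => [B B'|a B|y]; rewrite /psi.
- rewrite qfD [RHS]addrACA -opprD -(meanD sm); congr (_ - _); congr sph.
  by apply/funext => z; rewrite qfD mulrDl.
- rewrite qfZ mulrBr -(meanZ sm); congr (_ - _); congr sph.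
  by apply/funext => z; rewrite qfZ mulrA.
rewrite qf_outer.
have -> : (fun z => qf (outer k y) z * ker x z) = (fun z =>
   (N * n.+1%:R) * (sqn (dot k z x) ^+ 1 * sqn (dot k z y)) +
   (- N) * sqn (dot k z y) ^+ 1).
  by apply/funext => z; rewrite qf_outer /ker; ring.
rewrite (mean_lin sm) (meanZ sm) sph_mixed// sph_moment moment1 moment2 sqn_dotC.
have N0 : N != 0 by rewrite pnatr_eq0.
have M0 : n.+1%:R != 0 :> R by rewrite pnatr_eq0.
by rewrite (sqn_dotC y x); move: N0 M0; move: N (n.+1%:R : R) => a b a0 b0; field; rewrite a0 b0.
Qed.

(** Reproducing the identity matrix shows that [ker x] has mean 1. *)
Lemma proj_const_ge1 : 1 <= proj_const.
Proof.
have sm := @sph_mean R k.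
have e1 : nrm2 k (fun i => (i == 0%N)%:R : C) = 1 := sphere0 R k.
rewrite -(sph_abs_ker e1); pose e i : C := (i == 0%N)%:R.
have -> : 1 = sph k (ker e).
  have := sph_reproducing (@selfadj1 R k) e1; rewrite qf1 e1 => <-.
  by apply: (mean_eq sm) => z zS; rewrite qf1 [nrm2 k z]zS mul1r.
apply: (mean_le sm); [exact: ker_bounded|apply: bounded_norm; exact: ker_bounded|].
by move=> z _; exact: ler_norm.
Qed.

Definition kermx x : 'M[C]_n :=
  (N * n.+1%:R)%:C%C *: outer k x - N%:C%C *: 1%:M.

Lemma qf_kermx x z : sphere k z -> qf (kermx x) z = ker z x.
Proof.
move=> zS; rewrite qfB !qfZ qf_outer qf1 [nrm2 k z]zS /ker sqn_dotC; ring.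
Qed.

Lemma selfadj_kermx x : selfadj (kermx x).
Proof.
by apply: selfadjB; apply: selfadjZ; [exact: selfadj_outer|exact: selfadj1].
Qed.

Lemma opnorm_ge0 A : selfadj A -> 0 <= opnorm A.
Proof.
move=> hA; exact: le_trans (normr_ge0 _) (qf_le_opnorm hA (sphere0 R k)).
Qed.

Lemma opnorm0 : opnorm (0 : 'M[C]_n) = 0.
Proof.
apply/eqP; rewrite eq_le opnorm_ge0 ?andbT; last exact: selfadj0.
apply: opnorm_le_qf; first exact: selfadj0.
by move=> z _; have := qfZ 0 (0 : 'M[C]_n) z; rewrite scaler0 mul0r => ->; rewrite normr0.
Qed.

Lemma lipc_ge0 (Z : Type) (rho : Z -> Z -> R) X (f : Z -> 'M[C]_n) :
  (0%:E <= lipc rho X f)%E.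
Proof. by apply: ereal_sup_ubound; left. Qed.

Lemma metric_gt0 (Z : Type) (rho : Z -> Z -> R) p q :
  is_metric rho -> p <> q -> 0 < rho p q.
Proof.
move=> [h1 h2 _ _] pq; rewrite lt_neqAle h1 andbT eq_sym.
by apply/eqP => /h2.
Qed.

Lemma lipc_lipschitz (Z : Type) (rho : Z -> Z -> R) X (f : Z -> 'M[C]_n) (l : R) p q :
  is_metric rho -> (lipc rho X f <= l%:E)%E -> X p -> X q ->
  opnorm (f p - f q) <= l * rho p q.
Proof.
move=> hm hl Xp Xq; have [<-|pq] := pselect (p = q).
  by rewrite subrr opnorm0; case: hm => _ h _ _; rewrite (proj2 (h p p) erefl) mulr0.
have r0 := metric_gt0 hm pq; rewrite -ler_pdivrMr// -lee_fin.
by apply: le_trans hl; apply: ereal_sup_ubound; right; exists p, q.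
Qed.

Lemma lipc_le (Z : Type) (rho : Z -> Z -> R) X (f : Z -> 'M[C]_n) (l : R) :
  is_metric rho -> 0 <= l ->
  (forall p q, X p -> X q -> opnorm (f p - f q) <= l * rho p q) ->
  (lipc rho X f <= l%:E)%E.
Proof.
move=> hm l0 h; apply: ge_ereal_sup => _ [->|[p [q [Xp Xq pq ->]]]].
  by rewrite lee_fin.
by rewrite lee_fin ler_pdivrMr ?h//; exact: metric_gt0.
Qed.

Lemma proj_const_admissible : LE_admissible n proj_const.
Proof.
move=> Z rho hm X f fsa; have sm := @sph_mean R k.
have P1 := proj_const_ge1; have P0 : 0 < proj_const := lt_le_trans ltr01 P1.
have [[x0 Xx0]|X0] := pselect (X !=set0); last first.
  exists (fun=> 0); split=> [_|p Xp|]; first exact: selfadj0.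
    by case: X0; exists p.
  apply: (@le_trans _ _ 0%:E); last by rewrite mule_ge0 ?lee_fin ?lipc_ge0// ltW.
  by apply: lipc_le => // p q _ _; rewrite subrr opnorm0 mul0r.
case El : (lipc rho X f) => [l||]; last first.
- by have := lipc_ge0 rho X f; rewrite El.
(* If [f] is not Lipschitz, any extension will do, since the bound is a positive multiple of
   infinity. *)
- exists (fun p => if pselect (X p) then f p else 0); split=> [p|p Xp|].
  + by case: pselect => [Xp|_] /=; [exact: fsa|exact: selfadj0].
  + by case: pselect.
  + by rewrite gt0_muley ?lte_fin// leey.
have l0 : 0 <= l by have := lipc_ge0 rho X f; rewrite El.
have flip p q : X p -> X q -> opnorm (f p - f q) <= l * rho p q.
  by apply: lipc_lipschitz => //; rewrite El.
have ulip z : sphere k z -> forall p q, X p -> X q ->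
    `|qf (f p) z - qf (f q) z| <= l * rho p q.
  move=> zS p q Xp Xq; rewrite -qfB; apply: le_trans (flip p q Xp Xq).
  by apply: qf_le_opnorm => //; apply: selfadjB; exact: fsa.
(* Each scalar function is extended without loss; the factor [proj_const] arises only when the
   values at all [z] are reassembled into a matrix. *)
pose F z p := mcshane rho X l (fun q => qf (f q) z) p.
pose g p : 'M[C]_n := sph_mx (fun z => (F z p)%:C%C *: kermx z).
have gsa p : selfadj (g p).
  by apply: selfadj_sph_mx => z; apply: selfadjZ; exact: selfadj_kermx.
have qg p x : sphere k x -> qf (g p) x = sph k (fun z => F z p * ker x z).
  move=> xS; rewrite qf_sph_mx; congr sph; apply/funext => z.
  by rewrite qfZ qf_kermx.
exists g; split=> //.
  move=> p Xp; apply: qf_inj => // [|x xS]; first exact: fsa.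
  rewrite qg// -[RHS](sph_reproducing (fsa p Xp) xS).
  apply: (mean_eq sm) => z zS; congr (_ * _).
  exact: (mcshane_ext hm Xx0 l0 (ulip z zS)).
have [rho0 _ _ _] := hm.
rewrite -EFinM; apply: lipc_le => //; first by rewrite mulr_ge0// ltW.
move=> p q _ _; apply: opnorm_le_qf => [|x xS]; first exact: selfadjB.
have bker := ker_bounded xS.
have bF : bounded_on (sphere k) (fun z => F z p - F z q).
  by exists (l * rho p q) => z zS; exact: (mcshane_lip hm Xx0 l0 (ulip z zS)).
have bA : bounded_on (sphere k) (fun z => (l * rho p q) * `|ker x z|).
  by apply: boundedM; [exact: bounded_cst|exact: bounded_norm].
have bFk := boundedM bF bker.
(* Integrating this bound gives [l * rho p q * proj_const] for the form at [x], hence for the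
   operator norm. *)
have le z : sphere k z -> `|(F z p - F z q) * ker x z| <= (l * rho p q) * `|ker x z|.
  move=> zS; rewrite normrM ler_wpM2r//.
  exact: (mcshane_lip hm Xx0 l0 (ulip z zS)).
have -> : proj_const * l * rho p q = (l * rho p q) * proj_const by ring.
rewrite qfB !qg// -(meanB sm) -(sph_abs_ker xS) -(meanZ sm).
have -> : (fun z => F z p * ker x z - F z q * ker x z) =
    fun z => (F z p - F z q) * ker x z by apply/funext => z; rewrite mulrBl.
rewrite ler_norml -(meanN sm); apply/andP; split; apply: (mean_le sm) => //.
- exact: boundedN.
- by move=> z /le; rewrite ler_norml => /andP[].
- by move=> z /le; rewrite ler_norml => /andP[].
Qed.

End UpperBound.

(** * The lower bound *)

Section BoundedFunctions.
Variables (R : realType) (T : Type) (t0 : T).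

Definition bfun : Type := {F : T -> R | bounded_on setT F}.

Implicit Types a b e : bfun.

Definition bval a : T -> R := sval a.

Lemma bfun_ext a b : (forall t, bval a t = bval b t) -> a = b.
Proof.
case: a b => [a ha] [b hb] /= h; have ab : a = b by apply/funext.
by move: ha hb h; rewrite ab => ha hb _; congr exist; exact: Prop_irrelevance.
Qed.

Definition badd a b : bfun := exist _ _ (boundedD (svalP a) (svalP b)).

Definition bscale (c : R) a : bfun :=
  exist _ _ (boundedM (bounded_cst setT c) (svalP a)).

Definition bmul a b : bfun := exist _ _ (boundedM (svalP a) (svalP b)).

Lemma baddA : associative badd.
Proof. by move=> a b c; apply: bfun_ext => t /=; rewrite addrA. Qed.

Lemma baddC : commutative badd.
Proof. by move=> a b; apply: bfun_ext => t /=; rewrite addrC. Qed.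

Definition bdist a b : R := sup [set `|bval a t - bval b t| | t in setT].

Lemma bdist_has_sup a b : has_sup [set `|bval a t - bval b t| | t in setT].
Proof.
split; first by exists `|bval a t0 - bval b t0|, t0.
have [K hK] := boundedB (svalP a) (svalP b).
by exists K => _ [t _ <-]; exact: hK.
Qed.

Lemma bdist_ub a b t : `|bval a t - bval b t| <= bdist a b.
Proof. by apply: ub_le_sup; [case: (bdist_has_sup a b)|exists t]. Qed.

Lemma bdist_le a b (M : R) : (forall t, `|bval a t - bval b t| <= M) -> bdist a b <= M.
Proof.
move=> h; apply: ge_sup; first by case: (bdist_has_sup a b).
by move=> _ [t _ <-].
Qed.

Lemma bdist_metric : is_metric bdist.
Proof.
split.
- by move=> a b; exact: le_trans (normr_ge0 _) (bdist_ub a b t0).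
- move=> a b; split=> [h|->].
    apply: bfun_ext => t; have := bdist_ub a b t; rewrite h normr_le0 subr_eq0.
    by move/eqP.
  apply/eqP; rewrite eq_le (le_trans (normr_ge0 _) (bdist_ub b b t0)) andbT.
  by apply: bdist_le => t; rewrite subrr normr0.
- have h a b : bdist a b <= bdist b a.
    by apply: bdist_le => t; rewrite distrC bdist_ub.
  by move=> a b; apply/eqP; rewrite eq_le !h.
- move=> a b c; apply: bdist_le => t.
  by rewrite (le_trans (ler_distD (bval b t) _ _))// lerD ?bdist_ub.
Qed.

Lemma bdist_badd a e (M : R) : (forall t, `|bval e t| <= M) -> bdist (badd a e) a <= M.
Proof.
by move=> h; apply: bdist_le => t /=; rewrite addrC addKr h.
Qed.

(** An additive map agrees with [x * h 1] on integers. Its deviation is therefore 1-periodic and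
    bounded, but it is also multiplied by [m] when [x] is, so it vanishes. *)
Lemma bounded_additive_linear (h : R -> R) (K : R) : (forall x y, h (x + y) = h x + h y) ->
  (forall x, `|h x| <= K * `|x|) -> forall x, h x = x * h 1.
Proof.
move=> hD hK.
have h0 : h 0 = 0 by have := hD 0 0; rewrite addr0; lra.
have hN x : h (- x) = - h x by have := hD x (- x); rewrite subrr h0; lra.
have hM m x : h (m%:R * x) = m%:R * h x.
  elim: m => [|m IH]; first by rewrite !mul0r.
  by rewrite -natr1 mulrDl mul1r hD IH; ring.
have hn m : h m%:R = m%:R * h 1 by rewrite -{1}[m%:R]mulr1 hM.
have hZ (z : int) : h z%:~R = z%:~R * h 1.
  case: z => m; first exact: hn.
  by rewrite NegzE rmorphN mulNr /= hN; congr (- _); exact: hn.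
have K0 : 0 <= K by have := le_trans (normr_ge0 _) (hK 1); rewrite normr1 mulr1.
move=> x; apply/eqP; rewrite -subr_eq0 -normr_le0 leNgt; apply/negP => d0.
set d := `|_| in d0.
pose m := (Num.truncn ((K + `|h 1|) / d)).+1.
have hm : K + `|h 1| < m%:R * d by rewrite -ltr_pdivrMr// truncnS_gt.
suff : m%:R * d <= K + `|h 1| by lra.
rewrite /d -{1}(ger0_norm (ler0n R m)) -normrM mulrBr -hM mulrA.
have fl : 0 <= m%:R * x - (Num.floor (m%:R * x))%:~R <= 1.
  have := real_floorD1_gt (num_real (m%:R * x)).
  have := real_floor_le (num_real (m%:R * x)); rewrite intrD mulr1z.
  by move=> h1 h2; apply/andP; split; lra.
set y := m%:R * x in fl *; set z : R := (Num.floor y)%:~R in fl *.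
have -> : h y - y * h 1 = h (y - z) - (y - z) * h 1.
  by rewrite hD hN /z hZ; ring.
have yz : `|y - z| <= 1 by case/andP: fl => ? ?; rewrite ger0_norm.
rewrite (le_trans (ler_normB _ _))// lerD//.
  by rewrite (le_trans (hK _))// -[leRHS]mulr1 ler_wpM2l.
by rewrite normrM -[leRHS]mul1r ler_wpM2r.
Qed.

End BoundedFunctions.

(** * Real coordinates on matrices and trace identities *)

Section Coordinates.
Variables (R : realType) (k : nat).
Local Notation C := R[i].
Local Notation Re := (@complex.Re R).
Local Notation Im := (@complex.Im R).
Local Notation n := k.+1.
Local Notation N := (k.+1%:R : R).
Local Notation J := ('I_n * 'I_n * bool)%type.
Implicit Types (A B : 'M[C]_n) (x y z : nat -> C).

(** Matrices as a real space of dimension [2 n^2]: the Boolean selects the imaginary part of an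
    entry. Real coordinates reduce a matrix-valued map to finitely many scalar ones that can be
    averaged. *)
Definition co (p : J) A : R :=
  if p.2 then Im (A p.1.1 p.1.2) else Re (A p.1.1 p.1.2).

Definition unit_mx (p : J) : 'M[C]_n :=
  (if p.2 then 'i%C else 1) *: delta_mx p.1.1 p.1.2.

Definition herm A : 'M[C]_n := (2^-1)%:C%C *: (A + adjmx A).

Lemma coD p A B : co p (A + B) = co p A + co p B.
Proof. by rewrite /co mxE; case: ifP => _; case: (A _ _) (B _ _) => [? ?] [? ?]. Qed.

Lemma coZ p (a : R) A : co p (a%:C%C *: A) = a * co p A.
Proof. by rewrite /co mxE; case: ifP => _; case: (A _ _) => [? ?] /=; ring. Qed.

Lemma coB p A B : co p (A - B) = co p A - co p B.
Proof.
have -> : - B = (-1)%:C%C *: B by rewrite rmorphN1 scaleN1r.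
by rewrite coD coZ mulN1r.
Qed.

Lemma sum_J (F : J -> R) :
  \sum_p F p = \sum_i \sum_j (F (i, j, false) + F (i, j, true)).
Proof.
rewrite (eq_bigr (fun p : J => F (p.1, p.2))); last by case.
rewrite -(pair_bigA _ (fun ij b => F (ij, b))) /=.
rewrite (eq_bigr (fun ij : 'I_n * 'I_n => \sum_b F (ij.1, ij.2, b))); last by case.
rewrite -(pair_bigA _ (fun i j => \sum_b F (i, j, b))) /=.
by apply: eq_bigr => i _; apply: eq_bigr => j _; rewrite big_bool addrC.
Qed.

Lemma qf_unit_mx p z : qf (unit_mx p) z =
  if p.2 then - Im (z p.1.2 * conjc (z p.1.1)) else Re (z p.1.2 * conjc (z p.1.1)).
Proof.
case: p => [[i j] b] /=; rewrite qfE (bigD1 i)//= (bigD1 j)//= !big1 ?addr0.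
- by rewrite !mxE !eqxx /=; case: b => /=; ring.
- by move=> l li; rewrite big1// => m _; rewrite !mxE (negbTE li) mulr0 /=; ring.
- by move=> l lj; rewrite !mxE (negbTE lj) andbF mulr0 /=; ring.
Qed.

Lemma qf_co A z : qf A z = \sum_p co p A * qf (unit_mx p) z.
Proof.
rewrite sum_J qfE; apply: eq_bigr => i _; apply: eq_bigr => j _.
by rewrite !qf_unit_mx /co /=; ring.
Qed.

Lemma sqn_dot_unit_mx z x :
  sqn (dot k z x) = \sum_p qf (unit_mx p) x * qf (unit_mx p) z.
Proof.
rewrite -qf_outer qf_co; apply: eq_bigr => -[[i j] b] _; congr (_ * _).
rewrite qf_unit_mx /co /= mxE.
by case: b; case: (x i) (x j) => [? ?] [? ?] /=; ring.
Qed.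

Lemma selfadj_herm A : selfadj (herm A).
Proof.
by apply: selfadjZ; rewrite /selfadj adjmxD adjmxK addrC.
Qed.

Lemma herm_id A : selfadj A -> herm A = A.
Proof.
move=> hA; rewrite /herm hA -mulr2n -scaler_nat scalerA.
have -> : (2^-1)%:C%C * 2%:R = 1 :> C.
  by rewrite -(rmorph_nat (real_complex R)) -rmorphM mulVf ?rmorph1// pnatr_eq0.
by rewrite scale1r.
Qed.

Lemma hermD A B : herm (A + B) = herm A + herm B.
Proof. by rewrite /herm adjmxD -scalerDr addrACA. Qed.

Lemma qf_herm A z : qf (herm A) z = qf A z.
Proof. by rewrite qfZ qfD qf_adj; field. Qed.

Definition trR A : R := \sum_i Re (A i i).

(** The trace of the real projection [herm], that is, the real dimension of the self-adjoint
    matrices. *)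
Lemma sum_co_herm : \sum_p co p (herm (unit_mx p)) = N ^+ 2.
Proof.
rewrite sum_J (eq_bigr (fun=> N)) => [|i _].
  by rewrite sumr_const card_ord -(mulr_natr N) expr2.
rewrite (eq_bigr (fun=> 1)) => [|j _]; first by rewrite sumr_const card_ord.
rewrite /co /herm /unit_mx /= !mxE !eqxx /=.
by rewrite (eq_sym i j) andbb; case: (j == i) => /=; field.
Qed.

Lemma trR_herm p : trR (herm (unit_mx p)) = co p 1%:M.
Proof.
case: p => [[i j] b]; rewrite /trR /co /herm /unit_mx /=.
rewrite (bigD1 i)//= big1 ?addr0 => [|l li].
  rewrite !mxE eqxx /=.
  by case: b; case: (i == j) => /=; field.
rewrite !mxE (negbTE li) /=.
by case: b => /=; field.
Qed.

Lemma sum_co1 : \sum_p co p (1%:M : 'M[C]_n) * co p 1%:M = N.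
Proof.
rewrite sum_J (eq_bigr (fun=> 1)) => [|i _]; first by rewrite sumr_const card_ord.
rewrite (bigD1 i)//= big1 ?addr0 => [|j ji].
  by rewrite /co /= !mxE eqxx /=; ring.
by rewrite /co /= !mxE eq_sym (negbTE ji) /=; ring.
Qed.

(** [coefA] and [coefB] are the numbers [a] and [b] for which the mean of [q(|<z, x>|^2) z z^*] is
    [a x x^* + b]; [sph_poly_qf] states this paired with a self-adjoint matrix. *)
Definition coefA (q : {poly R}) : R :=
  \sum_(d < size q) q`_d * (moment R n d.+1 / d.+1%:R * d%:R).
Definition coefB (q : {poly R}) : R :=
  \sum_(d < size q) q`_d * (moment R n d.+1 / d.+1%:R).

(** Reduction to rank-one matrices by linearity, then [sph_mixed] for each monomial of [q]. *)
Lemma sph_poly_qf q A x : selfadj A -> nrm2 k x = 1 ->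
  sph k (fun z => q.[sqn (dot k z x)] * qf A z) = coefA q * qf A x + coefB q * trR A.
Proof.
move=> hA x1; have sm := @sph_mean R k.
pose psi B := sph k (fun z => q.[sqn (dot k z x)] * qf B z) -
  (coefA q * qf B x + coefB q * trR B).
suff : psi A = 0 by move/eqP; rewrite subr_eq0 => /eqP.
apply: selfadj_span hA => [B B'|a B|y]; rewrite /psi.
- have -> : trR (B + B') = trR B + trR B'.
    by rewrite /trR -big_split; apply: eq_bigr => i _; rewrite mxE ReD.
  under [in LHS]eq_fun do rewrite qfD mulrDr.
  by rewrite (meanD sm) qfD; ring.
- have -> : trR (a%:C%C *: B) = a * trR B.
    by rewrite /trR mulr_sumr; apply: eq_bigr => i _; rewrite mxE ReZ.
  under [in LHS]eq_fun do rewrite qfZ mulrCA.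
  by rewrite (meanZ sm) qfZ; ring.
have -> : trR (outer k y) = nrm2 k y.
  by apply: eq_bigr => i _; rewrite mxE sqnE.
under [X in sph k X]eq_fun => z.
  rewrite qf_outer horner_coef mulr_suml.
  under eq_bigr do rewrite -mulrA.
  over.
rewrite (mean_sum sm); under eq_bigr do rewrite (meanZ sm) sph_mixed//.
rewrite qf_outer /coefA /coefB !mulr_suml -big_split -sumrB big1// => d _ /=.
ring.
Qed.

(** The left-hand side is what the trace computation in [lower_poly] produces. The monomials of [q]
    are compared one by one, using consecutive Beta moments. *)
Lemma coef_betamean q : (0 < k)%N ->
  coefA q * N ^+ 2 + coefB q * N =
  N * betamean k (fun t => q.[t] * (n.+1%:R * t - 1)).
Proof.
move=> k0; have bm := betamean_mean R k0.
under [in RHS]eq_fun => t.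
  rewrite horner_coef mulr_suml.
  under eq_bigr => d _.
    rewrite (_ : _ * _ = q`_d * (n.+1%:R * t ^+ d.+1 + (-1) * t ^+ d)); last first.
      by rewrite exprS; ring.
    over.
  over.
rewrite (mean_sum bm) /coefA /coefB !mulr_suml mulr_sumr -big_split.
apply: eq_bigr => d _ /=; rewrite (meanZ bm) (mean_lin bm) (meanZ bm).
rewrite !betamean_moment// !momentE /= addSn factS factS !natrM.
have h1 : d.+1%:R != 0 :> R by rewrite pnatr_eq0.
have h2 : (d + k)%N.+1%:R != 0 :> R by rewrite pnatr_eq0.
have h3 := fact_neq0 R (d + k).
have e1 : (d + k)%N.+1%:R = d.+1%:R + N - 1 :> R by rewrite -!natr1 natrD; ring.
have e2 : n.+1%:R = N + 1 :> R by rewrite natr1.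
have e3 : d%:R = d.+1%:R - 1 :> R by rewrite -natr1; ring.
rewrite e2 e3; rewrite e1 in h2 *.
move: h1 h2 h3; move: (d.+1%:R : R) N (d`!%:R : R) (k`!%:R : R) ((d + k)%N`!%:R : R).
by move=> D M u v w h1 h2 h3; field; rewrite h1 h2 h3.
Qed.

Lemma co_le_opnorm p A : selfadj A -> `|co p A| <= opnorm A.
Proof.
move=> hA; case: p => [[i j] b].
pose e (l : nat) : C := (l == j)%:R.
have e1 : nrm2 k e = 1.
  rewrite /nrm2 (bigD1 j)//= big1 ?addr0 => [|l lj].
    by rewrite /e eqxx /sqn /= expr0n addr0 expr1n.
  by rewrite /e val_eqE (negbTE lj) /sqn /= expr0n addr0.
have : Num.sqrt (nrm2 k (mv A e)) <= opnorm A.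
  apply: qf_nrm2_mv; rewrite ?e1// ?opnorm_ge0// => z zS.
  exact: qf_le_opnorm.
apply: le_trans; rewrite -(@ler_pXn2r _ 2)// ?nnegrE ?sqrtr_ge0//.
rewrite sqr_sqrtr ?nrm2_ge0// real_normK ?num_real//.
have mvE : mv A e i = A i j.
  rewrite /mv inord_val (bigD1 j)//= big1 ?addr0 => [|l lj].
    by rewrite /e eqxx mulr1.
  by rewrite /e val_eqE (negbTE lj) mulr0.
apply: (@le_trans _ _ (sqn (A i j))).
  by rewrite /co /sqn; case: b => /=; rewrite ?lerDl ?lerDr sqr_ge0.
rewrite -mvE /nrm2 (bigD1 i)//= lerDl sumr_ge0// => l _; exact: sqn_ge0.
Qed.

End Coordinates.

(** * Linearizing an extension and testing it on polynomials *)

Section LowerBound.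
Variables (R : realType) (k : nat).
Hypothesis k0 : (0 < k)%N.
Local Notation C := R[i].
Local Notation n := k.+1.
Local Notation N := (k.+1%:R : R).
Local Notation J := ('I_n * 'I_n * bool)%type.
Local Notation T := {z : nat -> C | sphere k z}.
Local Notation Z := (bfun R T).
Implicit Types (A B : 'M[C]_n) (x y z : nat -> C) (e : Z).

Definition pt0 : T := exist _ _ (sphere0 R k).

Lemma emb_bounded A : bounded_on setT (fun t : T => qf A (sval t)).
Proof.
by have [K hK] := qf_bounded A; exists K => t _; apply: hK; exact: svalP.
Qed.

(** Isometric on self-adjoint matrices, because their norm is the supremum of the quadratic form on
    the sphere. *)
Definition emb A : Z := exist _ _ (emb_bounded A).

Lemma embD A B : emb (A + B) = badd (emb A) (emb B).
Proof. by apply: bfun_ext => t; rewrite /= qfD. Qed.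

Lemma emb_inj A B : selfadj A -> selfadj B -> emb A = emb B -> A = B.
Proof.
move=> hA hB AB; apply: qf_inj => // z zS.
exact: (congr1 (fun e : Z => bval e (exist _ z zS)) AB).
Qed.

Lemma bound_bfun e : exists2 K : R, 0 <= K & forall t, `|bval e t| <= K.
Proof.
have [K hK] := svalP e; exists K; last by move=> t; exact: hK.
exact: le_trans (normr_ge0 _) (hK pt0 Logic.I).
Qed.

(** For a kernel that is a sum of products [b(z) a(t)], the function of [t] left after [w] acts on
    the [z]-factors; [w] will be evaluation at a point or a weighted mean over the sphere. *)
Definition bsum (s : seq (Z * ((nat -> C) -> R))) (w : ((nat -> C) -> R) -> R) : Z :=
  foldr (fun p a => badd (bscale (w p.2) p.1) a) (emb 0) s.

Lemma bval_bsum s w t : bval (bsum s w) t = \sum_(p <- s) w p.2 * bval p.1 t.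
Proof.
elim: s => [|p s IH]; last by rewrite big_cons -IH.
by rewrite big_nil /bsum /=; have := qfZ 0 (0 : 'M[C]_n) (sval t); rewrite scaler0 mul0r.
Qed.

(** For such kernels a linear functional acting in [t] commutes with the mean over [z]; no
    continuity is involved. *)
Definition finite_rank (K : (nat -> C) -> T -> R) :=
  exists s : seq (Z * ((nat -> C) -> R)),
    forall z t, K z t = \sum_(p <- s) p.2 z * bval p.1 t.

Lemma finite_rank1 a (b : (nat -> C) -> R) : finite_rank (fun z t => b z * bval a t).
Proof. by exists [:: (a, b)] => z t; rewrite big_seq1. Qed.

Lemma finite_rank0 : finite_rank (fun=> fun=> 0).
Proof. by exists [::] => z t; rewrite big_nil. Qed.

Lemma finite_rankD K K' : finite_rank K -> finite_rank K' ->
  finite_rank (fun z t => K z t + K' z t).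
Proof. by move=> [s h] [s' h']; exists (s ++ s') => z t; rewrite big_cat h h'. Qed.

Lemma finite_rankM K K' : finite_rank K -> finite_rank K' ->
  finite_rank (fun z t => K z t * K' z t).
Proof.
move=> [s h] [s' h'].
exists [seq (bmul p.1 p'.1, fun z => p.2 z * p'.2 z) | p <- s, p' <- s'] => z t.
rewrite h h' big_distrlr big_allpairs_dep /=; apply: eq_bigr => p _.
by apply: eq_bigr => p' _; rewrite /bval /=; ring.
Qed.

Lemma finite_rank_sum (I : Type) (r : seq I) (K : I -> (nat -> C) -> T -> R) :
  (forall i, finite_rank (K i)) -> finite_rank (fun z t => \sum_(i <- r) K i z t).
Proof.
move=> h; elim: r => [|i r IH].
  by have [s hs] := finite_rank0; exists s => z t; rewrite big_nil; exact: hs.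
have [s hs] := finite_rankD (h i) IH.
by exists s => z t; rewrite big_cons hs.
Qed.

(** [|<z, t>|^2] is a finite sum of products of quadratic forms in [z] and in [t], and finite-rank
    kernels form an algebra. This is why the tests are polynomials. *)
Lemma finite_rank_poly (q : {poly R}) :
  finite_rank (fun z (t : T) => q.[sqn (dot k z (sval t))]).
Proof.
have base : finite_rank (fun z (t : T) => sqn (dot k z (sval t))).
  have [s hs] := finite_rank_sum (index_enum _)
    (fun p : J => finite_rank1 (emb (unit_mx R p)) (qf (unit_mx R p))).
  exists s => z t; rewrite -hs sqn_dot_unit_mx.
  by apply: eq_bigr => p _; rewrite mulrC.
have cst a : finite_rank (fun=> fun _ : T => a).
  have [s hs] := finite_rank1 (emb 1%:M) (fun=> a).
  exists s => z t; rewrite -hs /= qf1.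
  by rewrite [nrm2 k _](svalP t) mulr1.
elim/poly_ind: q => [|q a IH].
  by have [s hs] := finite_rank0; exists s => z t; rewrite horner0; exact: hs.
have [s hs] := finite_rankD (finite_rankM IH base) (cst a).
by exists s => z t; rewrite hornerMXaddC hs.
Qed.

Section Linearization.
Variables (c : R) (g : Z -> 'M[C]_n).
Hypotheses (c0 : 0 <= c) (gsa : forall e, selfadj (g e))
  (gemb : forall A, selfadj A -> g (emb A) = A)
  (glip : forall a b, opnorm (g a - g b) <= c * bdist a b).

Let ginc a e (M : R) : (forall t, `|bval e t| <= M) ->
  opnorm (g (badd a e) - g a) <= c * M.
Proof.
move=> h; apply: le_trans (glip _ _) _; rewrite ler_wpM2l//.
exact: (bdist_badd pt0).
Qed.

Let coinc p a e (M : R) : (forall t, `|bval e t| <= M) ->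
  `|co p (g (badd a e) - g a)| <= c * M.
Proof.
by move=> h; apply: le_trans (ginc _ h); apply: co_le_opnorm; exact: selfadjB.
Qed.

(* Lindenstrauss' averaging: increments of [g] are averaged first over
   translations by self-adjoint matrices, which turns [g] into a map commuting
   with those translations, then over all translations, which makes it
   additive. *)
Lemma linearization : exists ell : J -> Z -> R,
  [/\ forall p e e', ell p (badd e e') = ell p e + ell p e',
      forall p (a : R) e, ell p (bscale a e) = a * ell p e,
      forall p B, selfadj B -> ell p (emb B) = co p B &
      forall e (M : R) z, (forall t, `|bval e t| <= M) -> sphere k z ->
        `|\sum_p ell p e * qf (unit_mx R p) z| <= c * M].
Proof.
have [m1 [mm1 inv1]] := invariant_mean R (0 : 'M[C]_n) (@addrA _) (@addrC _).
have [m2 [mm2 inv2]] := invariant_mean R (emb 0) (@baddA R T) (@baddC R T).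
pose q s A := badd s (emb A).
pose inner p e s := m1 (fun A => co p (g (badd (q s A) e) - g (q s A))).
pose ell p e := m2 (inner p e).
have inner_bound p e (M : R) s : (forall t, `|bval e t| <= M) -> `|inner p e s| <= c * M.
  by move=> h; apply: (mean_norm mm1) => A _; exact: coinc.
have ell_bound p e (M : R) : (forall t, `|bval e t| <= M) -> `|ell p e| <= c * M.
  by move=> h; apply: (mean_norm mm2) => s _; exact: inner_bound.
have ellD p e e' : ell p (badd e e') = ell p e + ell p e'.
  have [K K0 hK] := bound_bfun e.
  have bI : bounded_on setT (inner p e) by exists (c * K) => s _; exact: inner_bound.
  (* An increment along [e + e'] is one along [e'] from [s] followed by one along [e] from [s + e'];
     invariance of [m2] moves the second starting point back to [s]. *)
  rewrite /ell -(inv2 _ e' bI) -(meanD mm2); congr m2; apply/funext => s.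
  rewrite /inner -(meanD mm1); congr m1; apply/funext => A.
  rewrite -coD.
  have -> : badd (q s A) (badd e e') = badd (q (badd s e') A) e.
    by apply: bfun_ext => t /=; ring.
  have -> : q (badd s e') A = badd (q s A) e' by apply: bfun_ext => t /=; ring.
  by rewrite addrA subrK.
exists ell; split=> //.
- move=> p a e; have [K K0 hK] := bound_bfun e.
  have h1 (x y : R) : ell p (bscale (x + y) e) = ell p (bscale x e) + ell p (bscale y e).
    by rewrite -ellD; congr ell; apply: bfun_ext => t /=; rewrite mulrDl.
  have h2 (x : R) : `|ell p (bscale x e)| <= (c * K) * `|x|.
    rewrite -mulrA; apply: ell_bound => t /=; rewrite normrM mulrC.
    by apply: ler_wpM2r => //; exact: hK.
  rewrite (@bounded_additive_linear R (fun x : R => ell p (bscale x e)) _ h1 h2 a).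
  congr (_ * ell p _).
  by apply: bfun_ext => t /=; rewrite mul1r.
- move=> p B hB; rewrite /ell -[RHS](mean_cst mm2); congr m2; apply/funext => s.
  (* Since [g (emb A) = herm A], this differs from 0 only through the shift by [s], so it is
     bounded. Invariance of [m1] then cancels its increments and leaves the coordinate of [B]. *)
  pose W A := co p (g (q s A) - herm A).
  have [K K0 hK] := bound_bfun s.
  have bW : bounded_on setT W.
    exists (c * K) => A _.
    have -> : W A = co p (g (badd (emb A) s) - g (emb A)).
      rewrite /W /q baddC; congr (co p (_ - _)).
      rewrite -[LHS]gemb; last exact: selfadj_herm.
      by congr g; apply: bfun_ext => t /=; rewrite qf_herm.
    exact: coinc.
  have -> : inner p (emb B) s = m1 (fun A => (W (A + B) - W A) + co p B).
    congr m1; apply/funext => A; rewrite /W !coB hermD coD (herm_id hB).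
    have -> : badd (q s A) (emb B) = q s (A + B) by rewrite /q embD baddA.
    ring.
  by rewrite (meanD mm1) (meanB mm1) inv1// subrr add0r (mean_cst mm1).
- move=> e M z h zS.
  (* Summing over the coordinates before estimating writes this as one average of quadratic forms of
     increments of [g]; the constant stays [c], without a factor for the number of coordinates. *)
  have -> : \sum_p ell p e * qf (unit_mx R p) z =
      m2 (fun s => m1 (fun A => qf (g (badd (q s A) e) - g (q s A)) z)).
    rewrite (eq_bigr (fun p => m2 (fun s => m1 (fun A =>
      qf (unit_mx R p) z * co p (g (badd (q s A) e) - g (q s A)))))); last first.
      move=> p _; rewrite mulrC -(meanZ mm2); congr m2; apply/funext => s.
      by rewrite (meanZ mm1).
    rewrite -(mean_sum mm2); congr m2; apply/funext => s.
    rewrite -(mean_sum mm1); congr m1; apply/funext => A.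
    by rewrite [RHS]qf_co; apply: eq_bigr => p _; rewrite mulrC.
  apply: (mean_norm mm2) => s _; apply: (mean_norm mm1) => A _.
  apply: le_trans (ginc (q s A) h); apply: qf_le_opnorm => //.
  exact: selfadjB.
Qed.

(** The linear map given by [ell] is applied to [H z], the function [q(|<z, t>|^2)] of [t], paired
    with the form at [z] and averaged. Each value is at most [c]; moving the average inside leaves
    only functions on which [ell] is known. *)
Lemma lower_poly (q : {poly R}) : (forall t, 0 <= t <= 1 -> `|q.[t]| <= 1) ->
  N * betamean k (fun t => q.[t] * (n.+1%:R * t - 1)) <= c.
Proof.
move=> q1; have sm := @sph_mean R k.
have [ell [ellD ellZ ellE ellB]] := linearization.
have [s hs] := finite_rank_poly q.
have ell_bsum p w : ell p (bsum s w) = \sum_(u <- s) w u.2 * ell p u.1.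
  elim: (s) => [|u r IH]; last by rewrite big_cons /= ellD ellZ IH.
  rewrite big_nil /bsum /= ellE; last exact: selfadj0.
  by have := coZ p 0 (0 : 'M[C]_n); rewrite scaler0 mul0r.
pose H z := bsum s (fun b => b z).
have HE z t : bval (H z) t = q.[sqn (dot k z (sval t))] by rewrite bval_bsum hs.
have bnd z : sphere k z -> `|\sum_p ell p (H z) * qf (unit_mx R p) z| <= c.
  move=> zS; rewrite -[leRHS]mulr1; apply: ellB => // t.
  by rewrite HE; apply: q1; apply: sqn_dot_itv => //; exact: (svalP t).
have := mean_norm sm bnd; apply: le_trans; apply: le_trans (ler_norm _).
rewrite -coef_betamean// (mean_sum sm).
rewrite (eq_bigr (fun p => coefA k q * co p (herm (unit_mx R p)) +
   coefB k q * (co p 1%:M * co p 1%:M))); last first.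
  move=> p _; pose v := qf (unit_mx R p).
  transitivity (ell p (bsum s (fun b => sph k (fun z => b z * v z)))).
    rewrite ell_bsum; under [in LHS]eq_fun do rewrite ell_bsum mulr_suml.
    rewrite (mean_sum sm); apply: eq_bigr => u _.
    rewrite mulrC -(meanZ sm); congr sph; apply/funext => z; rewrite /v; ring.
  have hE := selfadj_herm (unit_mx R p).
  pose B := (coefA k q)%:C%C *: herm (unit_mx R p) + (coefB k q * co p 1%:M)%:C%C *: 1%:M.
  have hB : selfadj B by apply: selfadjD; apply: selfadjZ => //; exact: selfadj1.
  (* The average of [H z] weighted by the form of [unit_mx p] is again a quadratic form, by
     [sph_poly_qf]; so [ell] returns a coordinate of [B], whatever [g] was. *)
  have -> : bsum s (fun b => sph k (fun z => b z * v z)) = emb B.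
    apply: bfun_ext => t; have tS := svalP t.
    rewrite bval_bsum /= qfD (qfZ (coefA k q)) (qfZ (coefB k q * _)) qf1.
    rewrite [nrm2 k (sval t)]tS mulr1 -trR_herm.
    rewrite -sph_poly_qf//.
    rewrite (eq_bigr (fun u => sph k (fun z => bval u.1 t * (u.2 z * v z)))); last first.
      by move=> u _; rewrite (meanZ sm) mulrC.
    rewrite -(mean_sum sm); congr sph; apply/funext => z.
    rewrite hs mulr_suml; apply: eq_bigr => u _; rewrite qf_herm /v; ring.
  by rewrite ellE// coD (coZ p (coefA k q)) (coZ p (coefB k q * _)) mulrA.
(* The two trace identities give [a n^2 + b n]. *)
by rewrite big_split /= -!mulr_sumr sum_co_herm sum_co1.
Qed.

(** [lower_poly] is applied to polynomials close to the sign of [X t = (n+1)t - 1], smoothed by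
    [clamp] at scale [del]. *)
Lemma proj_const_le : proj_const R k <= c.
Proof.
have bm := betamean_mean R k0.
have M0 : 0 <= n.+1%:R :> R by rewrite ler0n.
apply/ler_addgt0Pr => eps e0.
(* The smoothing loses [del], the approximation loses [del] times the bound [n.+1 + 1] on [|X|], and
   the mean is multiplied by [N]; the total is [eps]. *)
pose del : R := eps / (N * (n.+1%:R + 1 + 1)).
have D0 : 0 < N * (n.+1%:R + 1 + 1).
  by rewrite mulr_gt0 ?ltr0n//; lra.
have d0 : 0 < del by rewrite divr_gt0.
pose X (t : R) : R := n.+1%:R * t - 1.
pose F t := clamp (del^-1 * X t).
have L0 : 0 <= del^-1 * n.+1%:R by rewrite mulr_ge0// invr_ge0 ltW.
have Flip s t : `|F s - F t| <= del^-1 * n.+1%:R * `|s - t|.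
  rewrite (le_trans (clamp_lip _ _))// -mulrBr normrM (gtr0_norm (x := del^-1)) ?invr_gt0//.
  rewrite -mulrA; apply: ler_wpM2l; first by rewrite invr_ge0 ltW.
  have -> : X s - X t = n.+1%:R * (s - t) by rewrite /X; ring.
  by rewrite normrM ger0_norm.
have [q hq] := lipschitz_poly_approx d0 L0 Flip.
have q1 t : 0 <= t <= 1 -> `|q.[t]| <= 1.
  by move=> /hq[_ h]; apply: h => x; exact: clamp_norm.
have := lower_poly q1.
have : betamean k (fun t => `|X t| - del * (n.+1%:R + 1 + 1)) <=
       betamean k (fun t => q.[t] * X t).
  have bX : bounded_on (itv01 (R:=R)) X.
    have [K hK] := poly_bounded (n.+1%:R *: 'X - 1%:P : {poly R}).
    by exists K => t /hK; rewrite hornerD hornerN hornerZ hornerX hornerC.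
  apply: (mean_le bm).
  - by apply: boundedB; [exact: bounded_norm|exact: bounded_cst].
  - by apply: boundedM => //; exact: poly_bounded.
  move=> t t01; have [h1 _] := hq t t01.
  have h2 := clamp_mul (del^-1 * X t).
  have h3 : `|X t| - del <= X t * F t.
    have := ler_wpM2l (ltW d0) h2; rewrite mulrBr mulr1 normrM.
    rewrite (gtr0_norm (x := del^-1)) ?invr_gt0// !mulrA divff ?gt_eqF// !mul1r.
    by rewrite -/(F t).
  have h4 : `|X t| <= n.+1%:R + 1.
    case/andP: t01 => t0 t1; rewrite (le_trans (ler_normB _ _))// normr1 lerD2r.
    by rewrite normrM !ger0_norm// -[leRHS]mulr1 ler_wpM2l.
  have h5 : `|(q.[t] - F t) * X t| <= del * (n.+1%:R + 1).
    by rewrite normrM ler_pM.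
  move: h5; rewrite ler_norml => /andP[h5 _]; rewrite mulrBl in h5.
  rewrite (mulrC (F t)) in h5; rewrite mulrDr mulr1.
  by move: h5; lra.
rewrite (meanB bm) (mean_cst bm) => /(ler_wpM2l (ler0n R n)) h1 h2.
have := le_trans h1 h2; rewrite mulrBr -/(proj_const R k).
have -> : N * (del * (n.+1%:R + 1 + 1)) = eps.
  by rewrite mulrCA /del divfK// gt_eqF.
by lra.
Qed.

End Linearization.

(** Admissibility is used for one problem: extending the inverse of [emb] from the embedded
    self-adjoint matrices to all bounded functions on the sphere. *)
Lemma admissible_ge_proj_const (c : R) : LE_admissible n c -> proj_const R k <= c.
Proof.
move=> adm; have hm := bdist_metric R pt0.
pose X : set Z := [set emb A | A in [set A | selfadj A]].
pose f (e : Z) : 'M[C]_n := xget 0 [set A | selfadj A /\ emb A = e].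
have fE A : selfadj A -> f (emb A) = A.
  move=> hA; have : [set B | selfadj B /\ emb B = emb A] (f (emb A)).
    by apply: (@xgetPex _ 0); exists A.
  by move=> [hf /emb_inj]; apply.
have fsa e : X e -> selfadj (f e) by move=> [A hA <-]; rewrite fE.
have lf : (lipc (@bdist R T) X f <= 1%:E)%E.
  apply: lipc_le => // _ _ [A hA <-] [B hB <-]; rewrite !fE// mul1r.
  apply: opnorm_le_qf => [|z zS]; first exact: selfadjB.
  by rewrite qfB; exact: (bdist_ub pt0 (emb A) (emb B) (exist _ z zS)).
have [g [gsa gE glip]] := adm Z _ hm X f fsa.
(* An admissible constant is not known to be nonnegative at this point, whereas [proj_const_le] asks
   for it. The alternative [proj_const <= 0] is excluded at the end by [proj_const_ge1]. *)
pose c' := Num.max c 0.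
have c'0 : 0 <= c' by rewrite le_max lexx orbT.
have gl : (lipc (@bdist R T) setT g <= c'%:E)%E.
  apply: (le_trans glip); apply: (@le_trans _ _ (c'%:E * lipc (@bdist R T) X f)%E).
    by rewrite lee_wpmul2r ?lipc_ge0// lee_fin le_max lexx.
  by rewrite -[leRHS]mule1 lee_wpmul2l// lee_fin.
have h : proj_const R k <= c'.
  apply: (@proj_const_le c' g) => // [A hA|a b].
    by rewrite gE ?fE//; exists A.
  exact: (lipc_lipschitz (X := setT)).
move: h; rewrite /c' le_max => /orP[//|h].
by have := proj_const_ge1 R k0; lra.
Qed.

End LowerBound.

Theorem theorem7p2 (R : realType) (n : nat) (hn : (2 <= n)%N) :
  LE_sa R n = ((2 * n%:R * (n%:R / (n.+1)%:R) ^+ n.-1 - 1 : R)%:E)%E.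
Proof.
(* The right-hand side becomes [proj_const] at [k = n - 1], the index by which the sphere of C^n is
   built. *)
rewrite -betamean_abs//; case: n hn => // k hk /=; have k0 : (0 < k)%N by [].
rewrite -/(proj_const R k); apply/eqP; rewrite eq_le; apply/andP; split.
  apply: ereal_inf_lbound; exists (proj_const R k) => //.
  exact: proj_const_admissible.
apply: le_ereal_inf_tmp => _ [c hc <-]; rewrite lee_fin.
exact: admissible_ge_proj_const hc.
Qed.
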